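(* Consider the model D-EX-N$(\zeta_n)$ described in the context with $\lim_{n\to\infty}\zeta_n=1$. The set of largest crossing points is $C_1=\{0\}\cup(t_2,\alpha)$, and \[ \operatorname{EER}_\infty(1)=\frac{t_2\,\Phi(x_0(t_2\mid1))}{\alpha}+\int_{t_2/\alpha}^{1}\Phi(x_0(\alpha t\mid 1))\,dt,\qquad \operatorname{FDR}_\infty(1)=\Phi(x_0(t_2\mid 1)). \]
   Context: Model D-EX-N$(\zeta_n)$: fix $\alpha\in(0,1)$ and $\rho\in(0,1)$, $\overline\rho=1-\rho$; $\Phi$ is the standard normal c.d.f. Let $X_0,X_1,\dots,X_n$ be i.i.d. $N(0,1)$. For $H_i:\vartheta_i=0$ vs $K_i:\vartheta_i>0$, $T_i=\vartheta_i+\sqrt{\overline\rho}X_i-\sqrt\rho X_0$ with $p$-values $p_i=1-\Phi(T_i)$; $\vartheta_i=\infty$ is allowed and gives $p_i=0$ a.s. For each $n$, exactly $n_0$ hypotheses are true ($\vartheta_i=0$), $\zeta_n=n_0/n$, the others have $\vartheta_i=\infty$. The LSU procedure at level $\alpha$ rejects all $H_i$ with $p_i\le m\alpha/n$, $m=\max\{i:p_{i:n}\le i\alpha/n\}$. $V_n$ = number of rejected true hypotheses, $R_n$ = number of rejections, $\operatorname{EER}_\infty(1)=\lim_n\mathbb E[V_n/n]$, $\operatorname{FDR}_\infty(1)=\lim_n\mathbb E[V_n/(R_n\vee1)]$. Given $X_0=x_0$, $F_\infty(t\mid x_0)=1-\Phi\big(\Phi^{-1}(1-t)/\sqrt{\overline\rho}+\sqrt{\rho/\overline\rho}\,x_0\big)$,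 $t\in(0,1)$, $F_\infty(0\mid x_0)=0$. For $t\in(0,\alpha)$, $F_\infty(t\mid x_0)=t/\alpha$ iff $x_0=x_0(t\mid1):=\sqrt{\overline\rho/\rho}\,\Phi^{-1}(1-t/\alpha)-\Phi^{-1}(1-t)/\sqrt\rho$. Let $t(x_0\mid1)=\sup\{t\in[0,\alpha]:F_\infty(t\mid x_0)=t/\alpha\}$, called a largest crossing point (LCP) when $F_\infty(\cdot\mid x_0)$ lies above $t/\alpha$ just to the left and below just to the right of it; $C_1$ is the set of LCPs. With $d(u\mid x_0,1)=1-\Phi(u/\sqrt{\overline\rho}+\sqrt{\rho/\overline\rho}\,x_0)-(1-\Phi(u))/\alpha$ and $u_2(x_0)=-x_0/\sqrt\rho-\sqrt{\overline\rho/\rho}\sqrt{x_0^2-2\ln(\sqrt{\overline\rho}/\alpha)}$, there is a unique tangent point: a value $x_0^*$ with $u_2(x_0^* )$ real and $d(u_2(x_0^* )\mid x_0^*,1)=0$ (where $F_\infty(\cdot\mid x_0^* )$ touches the line $t\mapsto t/\alpha$); $t_2=1-\Phi(u_2(x_0^* ))$, so that $x_0(t_2\mid1)=x_0^*$. *)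

(* Defs.v *)
From HB Require Import structures.
From mathcomp Require Import all_boot all_order all_algebra.
From mathcomp Require Import all_classical all_reals all_analysis.
From mathcomp Require Import normal_distribution.
Set Implicit Arguments. Unset Strict Implicit. Unset Printing Implicit Defensive.
Import Order.TTheory GRing.Theory Num.Theory.
Import numFieldNormedType.Exports.
Local Open Scope classical_set_scope.
Local Open Scope ring_scope.

Section Defs.
Context {R : realType}.

Definition Phi (x : R) : R := fine (normal_prob 0 1 `]-oo, x]).

(* Phi^{-1}: the (unique, for p in (0,1)) y with Phi y = p *)
Definition Phiinv (p : R) : R := xget 0 [set y | Phi y = p].

Variables (alpha rho : R).
Definition rhobar : R := 1 - rho.

Definition Finf (t x0 : R) : R :=
  if t == 0 then 0
  else 1 - Phi (Phiinv (1 - t) / Num.sqrt rhobar + Num.sqrt (rho / rhobar) * x0).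

Definition x0t (t : R) : R :=
  Num.sqrt (rhobar / rho) * Phiinv (1 - t / alpha) - Phiinv (1 - t) / Num.sqrt rho.

Definition tx0 (x0 : R) : R :=
  sup [set t | 0 <= t <= alpha /\ Finf t x0 = t / alpha].

Definition is_LCP (x0 t : R) : Prop :=
  t = tx0 x0 /\
  (exists2 e : R, 0 < e &
     forall s, 0 < s -> t - e < s -> s < t -> Finf s x0 > s / alpha) /\
  (exists2 e : R, 0 < e &
     forall s, t < s -> s < t + e -> Finf s x0 < s / alpha).

Definition C1 : set R := [set t | exists x0, is_LCP x0 t].

Definition dfun (u x0 : R) : R :=
  1 - Phi (u / Num.sqrt rhobar + Num.sqrt (rho / rhobar) * x0) - (1 - Phi u) / alpha.

Definition u2real (x0 : R) : Prop := 2 * ln (Num.sqrt rhobar / alpha) <= x0 ^+ 2.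

Definition u2 (x0 : R) : R :=
  - x0 / Num.sqrt rho
  - Num.sqrt (rhobar / rho) * Num.sqrt (x0 ^+ 2 - 2 * ln (Num.sqrt rhobar / alpha)).

Definition tangent_point (x0s : R) : Prop := u2real x0s /\ dfun (u2 x0s) x0s = 0.

End Defs.

Definition mutually_independent {R : realType} {d : measure_display}
  {T : measurableType d} (P : probability T R) (X : nat -> T -> R) : Prop :=
  forall (s : seq nat) (B : nat -> set R), uniq s ->
    (forall i, measurable (B i)) ->
    P (\bigcap_(i in [set` s]) (X i @^-1` B i)) =
    (\prod_(i <- s) P (X i @^-1` B i))%E.

Section Model.
Context {R : realType} {d : measure_display} {T : measurableType d}.
Variables (alpha rho : R) (X : nat -> T -> R) (tr : nat -> nat -> bool).
(* tr n i = true iff H_i (1 <= i <= n) is true (theta_i = 0) in the n-th problem;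
   otherwise theta_i = oo and p_i = 0. *)

Definition pval (n i : nat) (w : T) : R :=
  if tr n i then 1 - Phi (Num.sqrt (rhobar rho) * X i w - Num.sqrt rho * X 0 w)
  else 0.

Definition pvals (n : nat) (w : T) : seq R := [seq pval n i w | i <- iota 1 n].

(* ordered p-values p_{1:n} <= ... <= p_{n:n}; p_{k:n} = nth 0 sorted (k-1) *)
Definition sorted_pvals (n : nat) (w : T) : seq R := sort <=%R (pvals n w).

Definition LSU_cond (n : nat) (w : T) (k : nat) : bool :=
  (0 < k)%N && (nth 0 (sorted_pvals n w) k.-1 <= k%:R * alpha / n%:R).

Definition LSU_m (n : nat) (w : T) : nat :=
  (\max_(k < n.+1 | LSU_cond n w k) (k : nat))%N.

Definition rejected (n i : nat) (w : T) : bool :=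
  pval n i w <= (LSU_m n w)%:R * alpha / n%:R.

Definition Rn (n : nat) (w : T) : nat := count (fun i => rejected n i w) (iota 1 n).
Definition Vn (n : nat) (w : T) : nat :=
  count (fun i => tr n i && rejected n i w) (iota 1 n).

Definition zeta (n : nat) : R := (count (tr n) (iota 1 n))%:R / n%:R.
End Model.

(* Main.v *)
(** For a true hypothesis, p_i <= t means that X_i exceeds a bound which is
    increasing in X_0.  On {X_0 <= y} or on {y <= X_0} the random bound may thus
    be replaced by its value at y, so that no conditioning on X_0 is needed:
    everything reduces to counting the i with X_i >= z for fixed z, where
    Chebyshev's inequality suffices.  If F_oo(. | y) is above the line t/alpha
    at alpha s, then with high probability LSU rejects more than s n hypotheses
    on {X_0 <= y}; if it is below the line on [alpha s, alpha], then LSU rejects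
    at most s n hypotheses on {y <= X_0}.  As dfun is increasing, then
    decreasing, then increasing to the limit 0, the tangency at u2 makes
    x0t decreasing on (t2, alpha) and identifies the largest crossing point.
    The limit of EER is obtained by integrating the limits of the tail
    probabilities of the rejected fraction.  For FDR above the tangent value,
    the fraction of rejections tends to 0, and one has to exclude that a
    non-negligible part of few rejections is wrong: a union bound over dyadic
    blocks of the number of rejections works, because F_oo(t | y) = o(t) makes
    the Chebyshev bounds of the blocks sum to something small. *)

Require Import Defs.
From HB Require Import structures.
From mathcomp Require Import all_boot all_order all_algebra.
From mathcomp Require Import all_classical all_reals all_analysis.
From mathcomp Require Import normal_distribution measurable_realfun ring lra.
Import Order.TTheory GRing.Theory Num.Theory.
Import numFieldNormedType.Exports.
Local Open Scope classical_set_scope.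
Local Open Scope ring_scope.

(** * The standard normal distribution function *)

Section Phi.
Context {R : realType}.
Implicit Types (x y p : R).
Local Notation phi := (@normal_pdf R 0 1).
Local Notation gauss := (normal_prob 0 1 : probability _ R).

Lemma PhiE x : (Phi x)%:E = normal_prob 0 1 `]-oo, x].
Proof. by rewrite /Phi fineK // (fin_num_measure gauss). Qed.

Lemma normal_pdf_gt0 x : 0 < phi x.
Proof.
by rewrite normal_pdfE ?oner_eq0// mulr_gt0 ?normal_peak_gt0 ?oner_eq0// expR_gt0.
Qed.

Lemma is_derive_Phi x : is_derive x 1 Phi (phi x).
Proof.
(* Integrability is taken up to x + 1 so that x is interior to the interval on which the fundamental
   theorem of calculus is applied. *)
have intf : lebesgue_measure.-integrable `]-oo, x + 1] (EFin \o phi).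
  by apply: (integrableS _ _ (subsetT _)) => //; exact: integrable_normal_pdf.
have -> : Phi = (fun x => \int[lebesgue_measure]_(t in `]-oo, x]) phi t)%R by [].
have [|||d e] := @continuous_FTC1 R phi -oo%O x (x + 1) _ intf.
- by rewrite ltrDl.
- exact: ltNyr.
- by apply: continuous_normal_pdf; rewrite oner_eq0.
by apply: DeriveDef; [exact: d | rewrite -derive1E; exact: e].
Qed.

Lemma continuous_Phi : continuous (@Phi R).
Proof.
move=> x; have [d _] := is_derive_Phi x.
exact/differentiable_continuous/derivable1_diffP.
Qed.

Lemma Phi_lt : {homo (@Phi R) : x y / x < y}.
Proof.
move=> x y xy; have := @MVT R Phi phi x y xy (fun z _ => is_derive_Phi z).
case; first exact/continuous_subspaceT/continuous_Phi.
move=> z _ /(congr1 (fun z => z + Phi x)); rewrite subrK => ->.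
by rewrite ltrDr mulr_gt0 ?normal_pdf_gt0 ?subr_gt0.
Qed.

Lemma ler_Phi : {mono (@Phi R) : x y / x <= y}.
Proof. exact/le_mono/Phi_lt. Qed.

Lemma ltr_Phi : {mono (@Phi R) : x y / x < y}.
Proof. exact/leW_mono/ler_Phi. Qed.

(** The identity, seen as a random variable under the Gaussian law, has distribution function [Phi];
    the limits at both infinities are then those of any distribution function. *)
Let idTR : measurableTypeR R -> R := idfun.

#[local] HB.instance Definition _ :=
  @isMeasurableFun.Build _ _ _ _ idTR (@measurable_id _ _ setT).

Lemma cvg_Phiy : Phi x @[x --> +oo] --> (1 : R).
Proof.
have /fine_cvg := cvg_cdfy1 (idTR : {RV gauss >-> R}).
by apply: cvg_trans; apply: near_eq_cvg; near=> x.
Unshelve. all: by end_near. Qed.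

Lemma cvg_PhiNy : Phi x @[x --> -oo] --> (0 : R).
Proof.
have /fine_cvg := cvg_cdfNy0 (idTR : {RV gauss >-> R}).
by apply: cvg_trans; apply: near_eq_cvg; near=> x.
Unshelve. all: by end_near. Qed.

Lemma Phi_gt0 x : 0 < Phi x.
Proof.
apply: le_lt_trans (Phi_lt (x - 1) x _); last by rewrite ltrBlDr ltrDl.
by rewrite -lee_fin PhiE.
Qed.

Lemma Phi_lt1 x : Phi x < 1.
Proof.
apply: (lt_le_trans (Phi_lt x (x + 1) _)); first by rewrite ltrDl.
by rewrite -lee_fin PhiE (probability_le1 gauss).
Qed.

Lemma PhiK x : Phiinv (Phi x) = x.
Proof.
rewrite /Phiinv; case: xgetP => [y _ /(inc_inj ler_Phi)|/(_ x) h]; first by [].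
by exfalso; exact: h.
Qed.

(** The limits at both infinities and the intermediate value theorem give a preimage of p, which
    [PhiK] identifies with the chosen one. *)
Lemma PhiinvK p : 0 < p < 1 -> Phi (Phiinv p) = p.
Proof.
move=> /andP[p0 p1].
suff [x <-] : exists x, Phi x = p by rewrite PhiK.
have cf a b : {within `[a, b], continuous (@Phi R)}.
  exact/continuous_subspaceT/continuous_Phi.
have [a ap] : exists a, Phi a < p.
  near (ninfty_nbhs R) => a; exists a; near: a.
  exact: (cvgr_lt (0 : R) cvg_PhiNy).
have [b pb] : exists b, p < Phi b.
  near (pinfty_nbhs R) => b; exists b; near: b.
  exact: (cvgr_gt (1 : R) cvg_Phiy).
have ab : a <= b by rewrite -ler_Phi ltW// (lt_trans ap).
have [|x _ <-] := @IVT R Phi a b p ab (cf a b); last by exists x.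
have Pab : Phi a <= Phi b by rewrite ler_Phi.
by rewrite (min_idPl Pab) (max_idPr Pab) !ltW.
Unshelve. all: by end_near. Qed.

Lemma Phiinv_le p x : 0 < p < 1 -> (Phiinv p <= x) = (p <= Phi x).
Proof. by move=> hp; rewrite -ler_Phi PhiinvK. Qed.

Lemma Phiinv_ge p x : 0 < p < 1 -> (x <= Phiinv p) = (Phi x <= p).
Proof. by move=> hp; rewrite -ler_Phi PhiinvK. Qed.

Lemma Phiinv_lt p x : 0 < p < 1 -> (Phiinv p < x) = (p < Phi x).
Proof. by move=> hp; rewrite -ltr_Phi PhiinvK. Qed.

Lemma onem01 (t : R) : 0 < t < 1 -> 0 < 1 - t < 1.
Proof. by move=> /andP[h1 h2]; rewrite subr_gt0 h2 gtrBl. Qed.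

Lemma onem_PhiinvK (t : R) : 0 < t < 1 -> 1 - Phi (Phiinv (1 - t)) = t.
Proof. by move=> ht; rewrite PhiinvK ?onem01//; ring. Qed.

Lemma onem_Phi01 x : 0 < 1 - Phi x < 1.
Proof. by rewrite subr_gt0 Phi_lt1 gtrBl Phi_gt0. Qed.

(* No atom at x, so the closed upper tail also has mass 1 - Phi x. *)
Lemma normal_prob_itvcy x : normal_prob 0 1 `[x, +oo[ = (1 - Phi x)%:E.
Proof.
have -> : normal_prob 0 1 `[x, +oo[ = gauss (~` `]-oo, x[).
  by rewrite setCitvl.
rewrite probability_setC// EFinB PhiE; congr (1 - _)%E.
have -> : `]-oo, x]%classic = `]-oo, x[%classic `|` [set x] :> set R.
  by rewrite setUitv1.
rewrite measureU0//.
have /null_content_dominatesP := @normal_prob_dominates R 0 1.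
by apply=> //; exact: lebesgue_measure_set1.
Qed.
End Phi.

(** * Differences of Gaussian tails *)

Section tail_gap.
Context {R : realType}.
Variables (k c eta : R).
Hypotheses (k0 : 0 < k) (eta0 : 0 < eta).
Local Notation phi := (@normal_pdf R 0 1).

(** With eta = 1/alpha this is [dfun] at a fixed value of X_0. A free eta also allows comparison
    with arbitrarily small multiples of the Gaussian tail. *)
Definition tail_gap (u : R) := 1 - Phi (k * u + c) - eta * (1 - Phi u).

(* Has the sign of the derivative of tail_gap. *)
Definition gap_slope (u : R) := (k * u + c) ^+ 2 - u ^+ 2 + 2 * ln (eta / k).

Lemma is_derive_tail_gap (u : R) :
  is_derive u (1 : R) tail_gap (eta * phi u - k * phi (k * u + c)).
Proof.
have dlin : is_derive u (1 : R) (k *: (id : R -> R) + cst c) k.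
  by apply: is_derive_eq; rewrite addr0 /GRing.scale/= mulr1.
have dcomp : is_derive u (1 : R) (fun v => Phi (k * v + c)) (phi (k * u + c) * k).
  exact: (is_derive1_comp (is_derive_Phi _) dlin).
have d1 := is_derive_Phi u.
have := is_deriveB (is_deriveB (is_derive_cst (1 : R) u 1) dcomp)
  (is_deriveZ eta (is_deriveB (is_derive_cst (1 : R) u 1) d1)).
move=> d; apply: (is_derive_eq d).
by rewrite /GRing.scale/=; ring.
Qed.

(** The quotient of the two densities is the exponential of a quadratic polynomial in u, into which
    the factor k/eta enters through its logarithm. *)
Lemma tail_gap_derivE u : eta * phi u - k * phi (k * u + c) =
  eta * phi u * (1 - expR (- gap_slope u / 2)).
Proof.
rewrite mulrBr mulr1; congr (_ - _).
rewrite normal_pdfE ?oner_eq0// /normal_fun.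
rewrite (_ : - gap_slope u / 2 =
  - (k * u + c - 0) ^+ 2 / (1 ^+ 2 *+ 2) - (- (u - 0) ^+ 2 / (1 ^+ 2 *+ 2)) + ln (k / eta)).
  rewrite !expRD expRN lnK ?posrE ?divr_gt0//.
  have : expR (- (u - 0) ^+ 2 / (1 ^+ 2 *+ 2)) != 0 by rewrite gt_eqF ?expR_gt0.
  have e0 : eta != 0 by rewrite gt_eqF.
  set a := expR (- (u - 0) ^+ 2 / _); set b := expR (- (k * u + c - 0) ^+ 2 / _).
  by move=> a0; field; rewrite a0 e0.
have -> : ln (k / eta) = - ln (eta / k).
  by rewrite -lnV ?posrE ?divr_gt0// invf_div.
by rewrite /gap_slope; field.
Qed.

Lemma tail_gap_deriv_gt0 u :
  0 < gap_slope u -> 0 < eta * phi u - k * phi (k * u + c).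
Proof.
move=> q; rewrite tail_gap_derivE !mulr_gt0 ?normal_pdf_gt0// subr_gt0.
by rewrite -expR0 ltr_expR mulNr oppr_lt0 divr_gt0.
Qed.

Lemma tail_gap_deriv_lt0 u :
  gap_slope u < 0 -> eta * phi u - k * phi (k * u + c) < 0.
Proof.
move=> q; rewrite tail_gap_derivE pmulr_rlt0 ?mulr_gt0 ?normal_pdf_gt0//.
by rewrite subr_lt0 -[ltLHS]expR0 ltr_expR mulNr oppr_gt0 pmulr_llt0 ?invr_gt0.
Qed.

Lemma continuous_tail_gap : continuous tail_gap.
Proof.
move=> x; have [d _] := is_derive_tail_gap x.
exact/differentiable_continuous/derivable1_diffP.
Qed.

Lemma tail_gap_incr a b : a < b -> (forall u, a < u < b -> 0 < gap_slope u) ->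
  tail_gap a < tail_gap b.
Proof.
move=> ab q; have := MVT ab (fun z _ => is_derive_tail_gap z).
case; first exact/continuous_subspaceT/continuous_tail_gap.
move=> z; rewrite in_itv/= => /q/tail_gap_deriv_gt0 d.
move/(congr1 (fun z => z + tail_gap a)); rewrite subrK => ->.
by rewrite ltrDr mulr_gt0 // subr_gt0.
Qed.

Lemma tail_gap_decr a b : a < b -> (forall u, a < u < b -> gap_slope u < 0) ->
  tail_gap b < tail_gap a.
Proof.
move=> ab q; have := MVT ab (fun z _ => is_derive_tail_gap z).
case; first exact/continuous_subspaceT/continuous_tail_gap.
move=> z; rewrite in_itv/= => /q/tail_gap_deriv_lt0 d.
move/(congr1 (fun z => z + tail_gap a)); rewrite subrK => ->.
by rewrite gtrDr pmulr_llt0 // subr_gt0.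
Qed.

Lemma cvg_linear_y : k * u + c @[u --> +oo] --> +oo.
Proof.
apply/cvgryPge => A; near=> u.
by rewrite -lerBlDr mulrC -ler_pdivrMr.
Unshelve. all: by end_near. Qed.

Lemma cvg_linear_Ny : k * u + c @[u --> -oo] --> -oo.
Proof.
apply/cvgrNyPle => A; near=> u.
by rewrite -lerBrDr mulrC -ler_pdivlMr.
Unshelve. all: by end_near. Qed.

Lemma cvg_tail_gap_y : tail_gap u @[u --> +oo] --> (0 : R).
Proof.
have -> : (0 : R) = 1 - 1 - eta * (1 - 1) by rewrite subrr mulr0 subrr.
apply: cvgB; first (apply: cvgB; first exact: cvg_cst).
  exact: (cvg_comp _ _ cvg_linear_y cvg_Phiy).
by apply: cvgMr; apply: cvgB; [exact: cvg_cst|exact: cvg_Phiy].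
Qed.

Lemma cvg_tail_gap_Ny : tail_gap u @[u --> -oo] --> 1 - eta.
Proof.
have -> : 1 - eta = 1 - 0 - eta * (1 - 0) by rewrite !subr0 mulr1.
apply: cvgB; first (apply: cvgB; first exact: cvg_cst).
  exact: (cvg_comp _ _ cvg_linear_Ny cvg_PhiNy).
by apply: cvgMr; apply: cvgB; [exact: cvg_cst|exact: cvg_PhiNy].
Qed.

(** Beyond a the function increases strictly towards its limit 0. *)
Lemma tail_gap_lt0 a : (forall u, a < u -> 0 < gap_slope u) ->
  forall u, a <= u -> tail_gap u < 0.
Proof.
move=> q u au.
have uu1 : u < u + 1 by rewrite ltrDl.
(* The limit only bounds the value at u + 1 by 0 weakly; the strict increase from u to u + 1 makes
   the inequality strict. *)
have gap_lt : tail_gap u < tail_gap (u + 1).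
  by apply: tail_gap_incr uu1 _ => v /andP[uv _]; apply: q; exact: le_lt_trans uv.
apply: lt_le_trans gap_lt _.
apply: (cvgr_to_ge cvg_tail_gap_y); near=> v.
apply/ltW/tail_gap_incr => [|w /andP[uw _]].
  by near: v; apply: nbhs_pinfty_gt; rewrite num_real.
by apply: q; exact: le_lt_trans au (lt_trans uu1 uw).
Unshelve. all: by end_near. Qed.

(* As eta is arbitrary, this says F_oo(t | x) = o(t) as t --> 0. *)
Lemma tail_gap_lt0_near : 1 < k -> exists A, forall u, A <= u -> tail_gap u < 0.
Proof.
move=> k1; set M := c ^+ 2 + 2 * ln (eta / k).
(* For u > A the leading term (k^2 - 1) u^2 of [gap_slope] outweighs the linear term and the
   constant M; the summand 1 gives u > 1, hence |M| <= u |M|. *)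
pose A := 1 + (2 * k * `|c| + `|M|) / (k ^+ 2 - 1).
exists A; apply: tail_gap_lt0 => u Au.
have K : 0 < k ^+ 2 - 1 by rewrite subr_gt0 exprn_egt1 ?ltW.
have : A * (k ^+ 2 - 1) < u * (k ^+ 2 - 1) by rewrite ltr_pM2r.
rewrite /A mulrDl mul1r divfK ?gt_eqF// => h.
have A1 : 1 <= A.
  rewrite /A lerDl divr_ge0 ?(ltW K)// addr_ge0 ?normr_ge0//.
  by rewrite mulr_ge0 ?normr_ge0// mulr_ge0 ?ltW.
have u1 : 1 < u by exact: le_lt_trans A1 Au.
have [c1 c2] : - `|c| <= c /\ 0 <= `|c|.
  by rewrite normr_ge0; split => //; rewrite lerNl -normrN ler_norm.
have [M1 M2] : - `|M| <= M /\ 0 <= `|M|.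
  by rewrite normr_ge0; split => //; rewrite lerNl -normrN ler_norm.
rewrite (_ : gap_slope u = u * (u * (k ^+ 2 - 1)) + 2 * k * c * u + M); last first.
  by rewrite /gap_slope /M; ring.
have h1 : u * (k ^+ 2 - 1 + (2 * k * `|c| + `|M|)) < u * (u * (k ^+ 2 - 1)).
  by rewrite ltr_pM2l// (lt_trans ltr01).
have h2 : - (u * (2 * k * `|c|)) <= 2 * k * c * u.
  rewrite (_ : _ * u = u * (2 * k * c)); last by ring.
  rewrite -mulrN ler_pM2l ?(lt_trans ltr01)// -mulrN ler_pM2l//.
  by rewrite mulr_gt0.
have h3 : `|M| <= u * `|M| by rewrite ler_peMl// ltW.
have h4 : 0 < u * (k ^+ 2 - 1) by rewrite mulr_gt0// (lt_trans ltr01).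
rewrite !mulrDr in h1; lra.
Qed.

End tail_gap.

(** * Crossing points *)

Section crossing.
Context {R : realType}.
Variables (alpha rho : R).
Hypotheses (alpha01 : 0 < alpha < 1) (rho01 : 0 < rho < 1).
Implicit Types (u x t s : R).
Local Notation slope := (Num.sqrt (rhobar rho))^-1.
Local Notation load := (Num.sqrt (rho / rhobar rho)).
Local Notation d := (dfun alpha rho).
Local Notation L := (ln (Num.sqrt (rhobar rho) / alpha)).

Let a0 : 0 < alpha. Proof. by case/andP: alpha01. Qed.
Let a1 : alpha < 1. Proof. by case/andP: alpha01. Qed.
Let r0 : 0 < rho. Proof. by case/andP: rho01. Qed.
Let r1 : rho < 1. Proof. by case/andP: rho01. Qed.
Let rb0 : 0 < rhobar rho. Proof. by rewrite /rhobar subr_gt0. Qed.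
Let sb0 : 0 < Num.sqrt (rhobar rho). Proof. by rewrite sqrtr_gt0. Qed.
Let sr0 : 0 < Num.sqrt rho. Proof. by rewrite sqrtr_gt0. Qed.

Lemma load_gt0 : 0 < load.
Proof. by rewrite sqrtr_gt0 divr_gt0. Qed.

Lemma slope_gt0 : 0 < slope.
Proof. by rewrite invr_gt0. Qed.

Lemma slope_gt1 : 1 < slope.
Proof.
rewrite invf_gt1// -[ltRHS]sqrtr1 ltr_sqrt// /rhobar.
by rewrite ltrBlDr ltrDl.
Qed.

Lemma dfunE u x : d u x = tail_gap slope (load * x) alpha^-1 u.
Proof. by rewrite /dfun /tail_gap (mulrC u) (mulrC (1 - Phi u)). Qed.

Lemma dfun_decr u x y : x < y -> d u y < d u x.
Proof.
move=> xy; rewrite /dfun ltrD2r ltrD2l ltrN2 ltr_Phi ltrD2l ltr_pM2l//.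
exact: load_gt0.
Qed.

(** The larger root of [gap_slope], whose smaller root is [u2], when the roots are real. *)
Definition u1 x := - x / Num.sqrt rho
  + Num.sqrt (rhobar rho / rho) * Num.sqrt (x ^+ 2 - 2 * L).

Lemma gap_slopeE u x : gap_slope slope (load * x) alpha^-1 u =
  rho / rhobar rho *
    ((u + x / Num.sqrt rho) ^+ 2 - rhobar rho / rho * (x ^+ 2 - 2 * L)).
Proof.
(* In terms of r = sqrt rho and b = sqrt (1 - rho) the identity is rational, with r^2 + b^2 = 1 as
   the only relation. *)
have key (r b l : R) : r != 0 -> b != 0 -> r ^+ 2 + b ^+ 2 = 1 ->
    (b^-1 * u + r / b * x) ^+ 2 - u ^+ 2 + 2 * l =
    r ^+ 2 / b ^+ 2 * ((u + x / r) ^+ 2 - b ^+ 2 / r ^+ 2 * (x ^+ 2 - 2 * l)).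
  move=> r_0 b_0 e; apply/eqP; rewrite -subr_eq0.
  rewrite (_ : _ - _ = (u ^+ 2 - x ^+ 2) * (1 - (r ^+ 2 + b ^+ 2)) / b ^+ 2).
    by rewrite e subrr mulr0 mul0r.
  by field; rewrite r_0 b_0.
have := key (Num.sqrt rho) (Num.sqrt (rhobar rho)) L.
rewrite !gt_eqF// !sqr_sqrtr ?ltW// => /(_ isT isT) <-.
  by rewrite /gap_slope invrK (mulrC alpha^-1) sqrtrM ?ltW// sqrtrV// ltW.
by rewrite /rhobar addrC subrK.
Qed.

Section shape.
Variable x : R.
Local Notation D := (x ^+ 2 - 2 * L).

Lemma gap_slope_gt0 : D < 0 -> forall u, 0 < gap_slope slope (load * x) alpha^-1 u.
Proof.
move=> D0 u; rewrite gap_slopeE mulr_gt0 ?divr_gt0//.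
by rewrite ltr_wpDl ?sqr_ge0// oppr_gt0 pmulr_rlt0 ?divr_gt0.
Qed.

Lemma gap_slope_factor u : 0 <= D -> gap_slope slope (load * x) alpha^-1 u =
  rho / rhobar rho * ((u - u1 x) * (u - u2 alpha rho x)).
Proof.
move=> D0; rewrite gap_slopeE; congr (_ * _).
rewrite -{1}(sqr_sqrtr D0) -(@sqr_sqrtr _ (rhobar rho / rho)) ?divr_ge0 ?ltW//.
by rewrite /u1 /u2; ring.
Qed.

Lemma u2_le_u1 : u2 alpha rho x <= u1 x.
Proof.
by rewrite lerD2l lerNl ge0_cp ?mulr_ge0 ?sqrtr_ge0.
Qed.

(** Without real roots of [gap_slope], [dfun] increases to its limit 0 and is negative throughout.
    Otherwise it increases up to u2, decreases up to u1, and increases to 0 afterwards, so that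
    zeros can only lie left of u1. *)
Lemma dfun_shape :
  (forall u, d u x < 0) \/
  [/\ u2 alpha rho x <= u1 x,
    forall u v, u < v -> v <= u2 alpha rho x -> d u x < d v x,
    forall u v, u2 alpha rho x <= u -> u < v -> v <= u1 x -> d v x < d u x &
    forall u, u1 x <= u -> d u x < 0].
Proof.
have [D0|D0] := ltP D 0; [left=> u | right; split].
- by rewrite dfunE; apply: (@tail_gap_lt0 _ _ _ _ _ _ u);
    rewrite ?invr_gt0// => v _; apply: gap_slope_gt0.
- exact: u2_le_u1.
- move=> u v uv vu2; rewrite !dfunE; apply: tail_gap_incr; rewrite ?invr_gt0//.
  move=> w /andP[uw wv]; rewrite gap_slope_factor// mulr_gt0 ?divr_gt0// nmulr_rgt0.
    by rewrite subr_lt0 (lt_le_trans wv).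
  by rewrite subr_lt0 (lt_le_trans wv)// (le_trans vu2)// u2_le_u1.
- move=> u v u2u uv vu1; rewrite !dfunE; apply: tail_gap_decr; rewrite ?invr_gt0//.
  move=> w /andP[uw wv]; rewrite gap_slope_factor// pmulr_rlt0 ?divr_gt0// pmulr_llt0.
    by rewrite subr_lt0 (lt_le_trans wv).
  by rewrite subr_gt0 (le_lt_trans u2u).
- move=> u u1u; rewrite dfunE; apply: (@tail_gap_lt0 _ _ _ _ _ _ (u1 x));
    rewrite ?invr_gt0//.
  move=> w uw; rewrite gap_slope_factor// mulr_gt0 ?divr_gt0// mulr_gt0// subr_gt0//.
  exact: le_lt_trans u2_le_u1 uw.
Qed.
End shape.

Lemma continuous_dfun x : continuous (d ^~ x).
Proof.
rewrite (_ : d ^~ x = tail_gap slope (load * x) alpha^-1); last first.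
  by apply/funext => u; rewrite dfunE.
by apply: continuous_tail_gap; rewrite ?invr_gt0.
Qed.

(** As the slope exceeds 1, small p-values are rarer than any multiple of their level. This keeps
    the dyadic blocks in [whp_Vn_le] under control. *)
Lemma dfun_tail (eta c : R) : 0 < eta -> exists A, forall u, A <= u ->
  1 - Phi (slope * u + c) <= eta * (1 - Phi u).
Proof.
move=> eta0; have [A hA] := tail_gap_lt0_near slope c eta slope_gt0 eta0 slope_gt1.
by exists A => u /hA; rewrite /tail_gap subr_lt0 => /ltW.
Qed.

(** * Zeros and crossing points relative to the tangent value of X_0 *)

Variable x0s : R.
Hypothesis tangent : tangent_point alpha rho x0s.
Local Notation uc := (u2 alpha rho x0s).

(** The zero at [uc] excludes the everywhere negative shape. In the other shape, the value 0 at [uc]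
    is the strict maximum left of u1, and from u1 on [dfun] is negative. *)
Lemma dfun_tangent_lt0 u : u != uc -> d u x0s < 0.
Proof.
case: tangent => _ duc; case: (dfun_shape x0s) => [h _|[h1 h2 h3 h4]].
  by have := h uc; rewrite duc ltxx.
(* If the two roots coincided, [dfun] would be negative at [uc]. *)
have uc1 : uc < u1 x0s.
  rewrite lt_neqAle h1 andbT; apply/eqP => e.
  by have := h4 uc; rewrite e lexx -e duc ltxx => /(_ isT).
move=> uuc; have [u1u|uu1] := leP (u1 x0s) u; first exact: h4.
rewrite -duc; have [uuc'|] := ltP u uc; first by apply: h2.
by rewrite le_eqVlt eq_sym (negPf uuc)/= => ucu; apply: h3 => //; exact: ltW.
Qed.

Lemma dfun_tangent_le0 u : d u x0s <= 0.
Proof.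
have [->|/dfun_tangent_lt0/ltW//] := eqVneq u uc.
by case: tangent => _ ->.
Qed.

Lemma dfun_gt_lt0 x u : x0s < x -> d u x < 0.
Proof. by move/(dfun_decr u)/lt_le_trans; apply; exact: dfun_tangent_le0. Qed.

Lemma dfun_crit_gt0 x : x < x0s -> 0 < d uc x.
Proof. by move/(dfun_decr uc); case: tangent => _ ->. Qed.

Lemma dfun_zero_lt x a : a < uc -> d a x = 0 -> x < x0s.
Proof.
move=> auc da; rewrite ltNge le_eqVlt; apply/negP => /orP[/eqP e|/dfun_gt_lt0].
  by have := dfun_tangent_lt0 a; rewrite lt_eqF// e da ltxx => /(_ isT).
by move=> /(_ a); rewrite da ltxx.
Qed.

(** The value at [uc] is positive, so the zero a must lie on the first increasing branch: on the
    decreasing branch, the value at [uc] would be below that at a. Between a and [uc], points of the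
    increasing branch lie above the zero, and points of the decreasing branch lie above the value at
    [uc]. *)
Lemma dfun_zero_cross x a : a < uc -> d a x = 0 ->
  (forall u, u < a -> d u x < 0) /\ (forall u, a < u -> u <= uc -> 0 < d u x).
Proof.
move=> auc da; have duc := dfun_crit_gt0 _ (dfun_zero_lt _ _ auc da).
case: (dfun_shape x) => [h|[h1 h2 h3 h4]].
  by have := h a; rewrite da ltxx.
have ucu1 : uc < u1 x.
  by rewrite ltNge; apply/negP => /h4/(lt_trans duc); rewrite ltxx.
have au2 : a <= u2 alpha rho x.
  rewrite leNgt; apply/negP => /ltW u2a.
  have := h3 _ _ u2a auc (ltW ucu1); rewrite da => /(lt_trans duc).
  by rewrite ltxx.
split => [u ua|u au uuc]; first by rewrite -da; exact: h2.
have [uu2|u2u] := leP u (u2 alpha rho x); first by rewrite -da; exact: h2.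
move: uuc; rewrite le_eqVlt => /orP[/eqP -> //|uuc].
by apply: lt_trans duc _; apply: h3 => //; exact: ltW.
Qed.

(** Intermediate value theorem between the limit 1 - 1/alpha < 0 at minus infinity and the positive
    value at [uc]. *)
Lemma dfun_zero_ex x : x < x0s -> exists2 a, a < uc & d a x = 0.
Proof.
move=> /dfun_crit_gt0 duc.
have [b buc db] : exists2 b, b < uc & d b x < 0.
  have lim : d u x @[u --> -oo] --> 1 - alpha^-1.
    rewrite (_ : d ^~ x = tail_gap slope (load * x) alpha^-1); last first.
      by apply/funext => u; rewrite dfunE.
    by apply: cvg_tail_gap_Ny; rewrite ?invr_gt0 // slope_gt0.
  near (ninfty_nbhs R) => b; exists b.
    by near: b; apply: nbhs_ninfty_lt; rewrite num_real.
  near: b; apply: (cvgr_lt (1 - alpha^-1)) => //.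
  by rewrite subr_lt0 invf_gt1.
have [|||a] := @IVT R (d ^~ x) b uc 0.
- exact: ltW.
- exact/continuous_subspaceT/continuous_dfun.
- by rewrite (min_idPl _) ?(max_idPr _) ?ltW// (lt_trans db).
rewrite in_itv/= => /andP[_ auc] da; exists a => //.
rewrite lt_neqAle auc andbT; apply/eqP => e.
by move: duc; rewrite -e da ltxx.
Unshelve. all: by end_near. Qed.

Lemma Finf_dfun t x : 0 < t < 1 -> Finf rho t x = t / alpha + d (Phiinv (1 - t)) x.
Proof.
move=> ht; rewrite /Finf gt_eqF ?(andP ht).1//.
by rewrite /dfun onem_PhiinvK// [RHS]addrC subrK.
Qed.

Lemma Finf_dfun_Phi u x : Finf rho (1 - Phi u) x = (1 - Phi u) / alpha + d u x.
Proof. by rewrite Finf_dfun ?onem_Phi01// subKr PhiK. Qed.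

Lemma dfun_x0t t : 0 < t < alpha -> d (Phiinv (1 - t)) (x0t alpha rho t) = 0.
Proof.
move=> /andP[t0 ta]; have t1 : 0 < t < 1 by rewrite t0 (lt_trans ta).
have key (r b u v : R) : 0 < r -> 0 < b -> u / b + r / b * (b / r * v - u / r) = v.
  by move=> h1 h2; field; rewrite !gt_eqF.
rewrite /dfun /x0t onem_PhiinvK// !sqrtrM ?ltW// !sqrtrV ?ltW// key ?sqrtr_gt0//.
by rewrite onem_PhiinvK ?subrr// divr_gt0// ltr_pdivrMr// mul1r.
Qed.

Lemma dfun_zero_lt_alpha u x : d u x = 0 -> 1 - Phi u < alpha.
Proof.
move/eqP; rewrite subr_eq0 => /eqP e.
by rewrite -[ltRHS]mul1r -ltr_pdivrMr// -e gtrBl Phi_gt0.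
Qed.

Lemma dfun_inj u : injective (d u).
Proof.
move=> x y e; have [xy|yx|//] := ltgtP x y.
  by have := dfun_decr u _ _ xy; rewrite e ltxx.
by have := dfun_decr u _ _ yx; rewrite e ltxx.
Qed.

Local Notation t2 := (1 - Phi uc).

Lemma t2_lt_alpha : t2 < alpha.
Proof. by case: tangent => _ /dfun_zero_lt_alpha. Qed.

(** Both sides are zeros of x |-> d uc x, which is injective. *)
Lemma x0t_t2 : x0t alpha rho t2 = x0s.
Proof.
have h : 0 < t2 < alpha by rewrite t2_lt_alpha subr_gt0 Phi_lt1.
apply: (@dfun_inj uc); case: tangent => _ ->.
by have := dfun_x0t _ h; rewrite subKr PhiK.
Qed.

Local Notation crossings x :=
  [set t | 0 <= t <= alpha /\ Finf rho t x = t / alpha].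

Lemma crossingP x t : 0 < t -> crossings x t -> d (Phiinv (1 - t)) x = 0.
Proof.
move=> t0 [/andP[_ ta]]; rewrite Finf_dfun => [h|].
  by apply: (@addrI _ (t / alpha)); rewrite h addr0.
by rewrite t0 (le_lt_trans ta).
Qed.

Lemma tx0_max x t : crossings x t -> (forall s, crossings x s -> s <= t) ->
  tx0 alpha rho x = t.
Proof.
move=> ht tub; apply/eqP; rewrite eq_le; apply/andP; split.
  by apply: ge_sup => //; exists t.
by apply: ub_le_sup => //; exists t.
Qed.

Lemma crossings0 x : crossings x 0.
Proof. by split; rewrite ?lexx ?ltW// /Finf eqxx mul0r. Qed.

Lemma tx0_gt x : x0s < x -> tx0 alpha rho x = 0.
Proof.
move=> xx; apply: tx0_max; first exact: crossings0.
move=> s hs; rewrite leNgt; apply/negP => s0.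
have := dfun_gt_lt0 _ (Phiinv (1 - s)) xx.
by rewrite (crossingP _ _ s0 hs) ltxx.
Qed.

Lemma crossings_Phi x u : d u x = 0 -> crossings x (1 - Phi u).
Proof.
move=> du; split; last by rewrite Finf_dfun_Phi du addr0.
by rewrite (ltW (dfun_zero_lt_alpha _ _ du)) subr_ge0 ltW ?Phi_lt1.
Qed.

Lemma tx0_tangent : tx0 alpha rho x0s = t2.
Proof.
apply: tx0_max; first by apply: crossings_Phi; case: tangent.
move=> s hs; have [s0|s0] := ltP 0 s; last first.
  by apply: le_trans s0 _; rewrite subr_ge0 ltW ?Phi_lt1.
case: (eqVneq (Phiinv (1 - s)) uc) => [<-|].
  by rewrite onem_PhiinvK// s0; case: hs => /andP[_ /le_lt_trans ->].
move/(dfun_tangent_lt0).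
by rewrite (crossingP _ _ s0 hs) ltxx.
Qed.

(** A crossing point beyond 1 - Phi a would give a zero of [dfun] left of a, where it is
    negative. *)
Lemma tx0_lt x a : a < uc -> d a x = 0 -> tx0 alpha rho x = 1 - Phi a.
Proof.
move=> auc da; apply: tx0_max; first exact: crossings_Phi.
move=> s hs; have [s0|s0] := ltP 0 s; last first.
  by apply: le_trans s0 _; rewrite subr_ge0 ltW ?Phi_lt1.
have [left_neg _] := dfun_zero_cross _ _ auc da.
have /eqP := crossingP _ _ s0 hs; apply: contraTT; rewrite -ltNge => h.
rewrite lt_eqF// left_neg// Phiinv_lt.
  by rewrite ltrBlDr addrC -ltrBlDr.
by apply: onem01; rewrite s0; case: hs => /andP[_ /le_lt_trans ->].
Qed.

(** Below the tangent value of X_0 the largest crossing comes from a zero left of [uc], above it 0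
    is the only crossing, and at the tangent value itself the curve touches the line without being
    above it, which excludes t2. *)
Lemma C1E : C1 alpha rho = [set 0] `|` `]t2, alpha[%classic.
Proof.
have t20 : 0 < t2 by rewrite subr_gt0 Phi_lt1.
apply/seteqP; split=> t.
- case=> x [tE [[e e0 hl] _]].
  have [xx|xx|xx] := ltgtP x x0s.
  + have [a auc da] := dfun_zero_ex _ xx.
    right; rewrite /= tE (tx0_lt _ _ auc da) in_itv/= (dfun_zero_lt_alpha _ _ da).
    by rewrite andbT ltrD2l ltrN2 ltr_Phi.
  + by left; rewrite tE tx0_gt.
  + exfalso; subst x; move: tE; rewrite tx0_tangent => tE.
    (* A point of the left neighbourhood that is also positive; there the curve would have to be
       above the line. *)
    have [s [s0 es st]] : exists s, [/\ 0 < s, t - e < s & s < t].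
      exists (Num.max (t / 2) (t - e / 2)); rewrite lt_max gt_max lt_max.
      rewrite tE divr_gt0//; split => //.
        by apply/orP; right; lra.
      by apply/andP; split; lra.
    have := hl _ s0 es st; rewrite Finf_dfun; last first.
      by rewrite s0 (lt_trans st)// tE (lt_trans t2_lt_alpha).
    by rewrite ltrDl ltNge (dfun_tangent_le0).
- case=> [->|].
  + exists (x0s + 1); split; first by rewrite tx0_gt// ltrDl.
    (* At t = 0 the left condition is vacuous: it concerns s with 0 < s < 0. *)
    split; first by exists 1 => // s s0 _ /(lt_trans s0); rewrite ltxx.
    exists alpha => // s s0; rewrite add0r => sa.
    rewrite Finf_dfun; last by rewrite s0 (lt_trans sa).
    by rewrite gtrDl (dfun_gt_lt0)// ltrDl.
  + rewrite /= in_itv/= => /andP[t2t ta].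
    have t0 : 0 < t by exact: lt_trans t2t.
    have t1 : 0 < t < 1 by rewrite t0 (lt_trans ta).
    have auc : Phiinv (1 - t) < uc.
      by rewrite Phiinv_lt ?onem01// ltrBlDr addrC -ltrBlDr.
    have da : d (Phiinv (1 - t)) (x0t alpha rho t) = 0.
      by apply: dfun_x0t; rewrite t0.
    (* As t = 1 - Phi u reverses the order, [hl] serves the right neighbourhood of t, up to alpha,
       and [hr] the left one, down to t2. *)
    have [hl hr] := dfun_zero_cross _ _ auc da.
    exists (x0t alpha rho t); split; first by rewrite (tx0_lt _ _ auc da) onem_PhiinvK.
    split.
      exists (t - t2); first by rewrite subr_gt0.
      move=> s s0; rewrite opprB addrC subrK => t2s st.
      have s1 : 0 < s < 1 by rewrite s0 (lt_trans st)// (lt_trans ta).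
      rewrite Finf_dfun// ltrDl hr//.
        by rewrite Phiinv_lt ?onem01// PhiinvK ?onem01// ltrD2l ltrN2.
      by rewrite Phiinv_le ?onem01// lerBlDr addrC -lerBlDr ltW.
    exists (alpha - t); first by rewrite subr_gt0.
    move=> s ts; rewrite addrC subrK => sa.
    have s1 : 0 < s < 1 by rewrite (lt_trans t0 ts) (lt_trans sa).
    rewrite Finf_dfun// gtrDl hl//.
    by rewrite Phiinv_lt ?onem01// PhiinvK ?onem01// ltrD2l ltrN2.
Qed.

End crossing.

(** * Counting independent events *)

Section event_counts.
Context {R : realType} {dT : measure_display} {T : measurableType dT}.
Variable P : probability T R.
Local Open Scope ereal_scope.

Lemma Lfun2_indic (A : set T) : measurable A -> (\1_A : T -> R) \in Lfun P 2%:E.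
Proof.
move=> mA; rewrite inE/=; apply/andP; split; rewrite inE//=.
rewrite /finite_norm unlock poweR_lty//.
under eq_integral => x _.
  rewrite /= (_ : (`|(\1_A x : R)| `^ 2)%R = \1_A x); last first.
    rewrite indicE; case: (_ \in _); rewrite /= ?normr1 ?powR1//.
    by rewrite normr0 powR0// pnatr_eq0.
  over.
by rewrite integral_indic// setIT (le_lt_trans (probability_le1 P mA))// ltry.
Qed.

Lemma Lfun1_indic (A : set T) : measurable A -> (\1_A : T -> R) \in Lfun P 1.
Proof.
move=> mA.
by apply: (Lfun_subset12 (fin_num_measure P _ measurableT)); exact: Lfun2_indic.
Qed.

Lemma covariance_indic (A B : set T) : measurable A -> measurable B ->
  covariance P \1_A \1_B = P (A `&` B) - P A * P B.
Proof.
move=> mA mB.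
have AB : (\1_A * \1_B)%R = \1_(A `&` B) :> (T -> R) by rewrite indicI.
have mAB : measurable (A `&` B) by exact: measurableI.
by rewrite covarianceE ?AB ?expectation_indic// Lfun1_indic.
Qed.

Variables (A : nat -> set T) (q : R).
Hypothesis mA : forall i, measurable (A i).
Hypothesis PA : forall i, P (A i) = q%:E.
Hypothesis indep : forall i j, i != j -> P (A i `&` A j) = P (A i) * P (A j).

Local Notation S n := (\sum_(i < n) (\1_(A i) : T -> R))%R.

Lemma Lfun2_count n : S n \in Lfun P 2%:E.
Proof.
elim: n => [|n IH]; first by rewrite big_ord0 (Lfun_cst P 0%R).
by rewrite big_ord_recr/= rpredD ?lee1n//= => _; rewrite Lfun2_indic.
Qed.

Lemma covariance_count n m : (n <= m)%N -> covariance P (S n) \1_(A m) = 0.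
Proof.
elim: n => [|n IH] nm; first by rewrite big_ord0 covariance_cst_l.
rewrite big_ord_recr/= covarianceDl ?Lfun2_indic ?Lfun2_count//.
rewrite IH ?(ltnW nm)// covariance_indic// indep ?subee ?adde0 ?neq_ltn ?nm//.
by rewrite !PA.
Qed.

(** Pairwise independence makes the variances q - q^2 add up. Dropping q^2 leaves a bound linear in
    q, which is useful for rare events. *)
Lemma variance_count n : 'V_P[S n] <= (n%:R * q)%:E.
Proof.
elim: n => [|n IH]; first by rewrite big_ord0 variance_cst mul0r.
rewrite big_ord_recr/= varianceD ?Lfun2_indic ?Lfun2_count//.
rewrite covariance_count// mule0 adde0 mulrSr mulrDl mul1r EFinD leeD//.
by rewrite /variance covariance_indic// setIid PA lee_fin gerBl -expr2 sqr_ge0.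
Qed.

Lemma expectation_count n : 'E_P[S n] = (n%:R * q)%:E.
Proof.
elim: n => [|n IH]; first by rewrite big_ord0 expectation_cst mul0r.
rewrite big_ord_recr/= expectationD ?Lfun1_indic//; last first.
  by apply: (Lfun_subset12 (fin_num_measure P _ measurableT)); exact: Lfun2_count.
by rewrite IH expectation_indic// PA mulrSr mulrDl mul1r EFinD.
Qed.

Lemma measurable_count n : measurable_fun setT (S n).
Proof.
by have /sub_Lfun_mfun := Lfun2_count n; rewrite inE.
Qed.

Lemma chebyshev_count n (delta : R) : (0 < delta)%R ->
  P [set w | (delta <= `|S n w - n%:R * q|)%R] <= (n%:R * q / delta ^+ 2)%:E.
Proof.
move=> d0.
pose Y : {RV P >-> R} := HB.pack (S n) (isMeasurableFun.Build _ _ _ _ _ (measurable_count n)).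
have := chebyshev Y d0; rewrite /Y/= expectation_count/= => /le_trans; apply.
rewrite mulrC EFinM lee_pmul2l ?variance_count//.
by rewrite lte_fin invr_gt0 exprn_gt0.
Qed.
End event_counts.

(** * The step-up procedure *)

Lemma measurable_count_ge {d : measure_display} {T : measurableType d}
  (b : nat -> T -> bool) (s : seq nat) (k : nat) :
  (forall i, measurable [set w | b i w]) ->
  measurable [set w | (k <= count (b ^~ w) s)%N].
Proof.
move=> mb; elim: s k => [|i s IH] k.
  rewrite /= leqn0; case: (k == 0%N) => /=.
    by rewrite (_ : [set _ | _] = setT)//; apply/seteqP; split.
  by rewrite (_ : [set _ | _] = set0)//; apply/seteqP; split.
rewrite (_ : [set _ | _] = ([set w | b i w] `&` [set w | (k.-1 <= count (b ^~ w) s)%N])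
    `|` [set w | (k <= count (b ^~ w) s)%N]).
  by apply: measurableU => //; exact: measurableI.
apply/seteqP; split => w /=.
  case: (b i w) => /= h; last by right.
  by left; split => //; rewrite -subn1 leq_subLR.
case=> [[-> h]|h]; last by rewrite (leq_trans h) ?leq_addl.
by rewrite add1n -ltnS; case: k h.
Qed.

Section step_up.
Context {R : realType} {dT : measure_display} {T : measurableType dT}.
Variables (alpha rho : R) (X : nat -> T -> R) (tr : nat -> nat -> bool).
Hypotheses (alpha01 : 0 < alpha < 1) (rho01 : 0 < rho < 1).
Local Notation slope := (Num.sqrt (rhobar rho))^-1.
Local Notation load := (Num.sqrt (rho / rhobar rho)).
Local Notation pv := (pval rho X tr).
Local Notation m := (LSU_m alpha rho X tr).

Let a0 : 0 < alpha. Proof. by case/andP: alpha01. Qed.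
Let a1 : alpha < 1. Proof. by case/andP: alpha01. Qed.

Definition small_pvals (n : nat) (t : R) (w : T) : nat :=
  count (fun i => pv n i w <= t) (iota 1 n).

Definition false_hyps (n : nat) : nat := count (fun i => ~~ tr n i) (iota 1 n).

Definition exceedances (n : nat) (y : R) (w : T) : nat :=
  count (fun i => y <= X i w) (iota 1 n).

(* X_i exceeds this bound iff p_i <= t, on the event X_0 = x. *)
Definition threshold (t x : R) : R := slope * Phiinv (1 - t) + load * x.

Lemma small_pvals_le n t w : (small_pvals n t w <= n)%N.
Proof. by rewrite -[leqRHS](size_iota 1) count_size. Qed.

Lemma small_pvals_mono n t s w : t <= s -> (small_pvals n t w <= small_pvals n s w)%N.
Proof. by move=> ts; apply: sub_count => i /= /le_trans; apply. Qed.

(** The k-th smallest p-value is at most t iff at least k p-values are. The bound k <= n keeps [nth]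
    away from its default value 0, which would pass the test. *)
Lemma LSU_condE n w k : (k <= n)%N ->
  LSU_cond alpha rho X tr n w k =
  (0 < k)%N && (k <= small_pvals n (k%:R * alpha / n%:R) w)%N.
Proof.
move=> kn; rewrite /LSU_cond; case: k kn => // k kn; rewrite !andTb.
set t := _ / _; set s := sorted_pvals _ _ _ _ _.
have ss : sorted <=%O s by exact: sort_le_sorted.
have cE : count (<= t) s = small_pvals n t w.
  by rewrite count_sort /pvals count_map.
have sz : size s = n by rewrite size_sort size_map size_iota.
rewrite -cE; apply/idP/idP => [h|h]; last exact: nth_count_le.
rewrite ltnNge; apply/negP => h'.
have := @nth_count_gt _ _ t 0 s k ss; rewrite h' sz kn => /(_ isT).
by rewrite ltNge h.
Qed.

Lemma LSU_m_le n w : (m n w <= n)%N.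
Proof. by apply/bigmax_leqP => i _; rewrite -ltnS. Qed.

Lemma LSU_m_ge n w k : (k <= n)%N ->
  (k <= small_pvals n (k%:R * alpha / n%:R) w)%N -> (k <= m n w)%N.
Proof.
case: k => // k kn h; have kn1 : (k.+1 < n.+1)%N by [].
apply: (bigop.bigmax_sup (Ordinal kn1)) => //=.
by rewrite LSU_condE.
Qed.

(** If the count c at the critical value of m exceeded m, then, critical values being increasing, c
    itself would satisfy the step-up condition, against the maximality of m. *)
Lemma small_pvals_LSU_m n w : small_pvals n ((m n w)%:R * alpha / n%:R) w = m n w.
Proof.
apply/eqP; rewrite eqn_leq; apply/andP; split.
  set c := small_pvals _ _ _; rewrite leqNgt; apply/negP => mc.
  have cn : (c <= n)%N by exact: small_pvals_le.
  suff /(LSU_m_ge _ _ _ cn) : (c <= small_pvals n (c%:R * alpha / n%:R) w)%N.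
    by rewrite leqNgt mc.
  rewrite {1}/c; apply: small_pvals_mono.
  by rewrite ler_wpM2r ?invr_ge0// ler_wpM2r ?(ltW a0)// ler_nat ltnW.
(* A maximum over a possibly empty range is either the default 0 or attained. *)
have [->//|] : m n w = 0%N \/ LSU_cond alpha rho X tr n w (m n w).
  rewrite {1 2}/LSU_m; elim/big_ind: _ => [|x y hx hy|i hi]; [by left| |by right].
  by case: (leqP x y).
by rewrite LSU_condE ?LSU_m_le// => /andP[].
Qed.

Lemma Rn_LSU_m n w : Rn alpha rho X tr n w = m n w.
Proof. exact: small_pvals_LSU_m. Qed.

(** False hypotheses have p-value 0 and are always rejected. Hence, for fixed n, V is a function of
    m alone. *)
Lemma VnE n w : (Vn alpha rho X tr n w + false_hyps n)%N = m n w.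
Proof.
rewrite -{1}small_pvals_LSU_m /Vn /false_hyps /small_pvals /rejected.
set t := _ / _.
have t0 : 0 <= t by rewrite divr_ge0// mulr_ge0// ltW.
rewrite -[RHS]size_filter -(count_predC (tr n)) !count_filter.
congr (_ + _)%N; apply: eq_count => i //=.
by rewrite /pval; case: (tr n i); rewrite //= t0.
Qed.

Lemma zetaE n : (0 < n)%N -> zeta tr n = 1 - (false_hyps n)%:R / n%:R :> R.
Proof.
move=> n0; rewrite /zeta /false_hyps.
have nn : n%:R != 0 :> R by rewrite pnatr_eq0 -lt0n.
apply: (@mulIf _ n%:R) => //; rewrite mulrBl !divfK// mul1r.
apply/eqP; rewrite eq_sym subr_eq -natrD -{1}(size_iota 1 n).
by rewrite -(count_predC (tr n)).
Qed.

Lemma pval_le n i (t : R) w : 0 < t < 1 -> tr n i ->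
  (pv n i w <= t) = (threshold t (X 0%N w) <= X i w).
Proof.
move=> ht tri; have r0 : 0 < rho by case/andP: rho01.
have rb0 : 0 < rhobar rho by rewrite /rhobar subr_gt0; case/andP: rho01.
rewrite /pval tri lerBlDr addrC -lerBlDr -Phiinv_le ?onem01//.
rewrite /threshold sqrtrM ?(ltW r0)// sqrtrV ?(ltW rb0)//.
rewrite -[RHS](ler_pM2l (_ : 0 < Num.sqrt (rhobar rho))) ?sqrtr_gt0// lerBrDr.
suff -> : Num.sqrt (rhobar rho) * ((Num.sqrt (rhobar rho))^-1 * Phiinv (1 - t) +
  Num.sqrt rho / Num.sqrt (rhobar rho) * X 0%N w) =
  Phiinv (1 - t) + Num.sqrt rho * X 0%N w by [].
by field; rewrite gt_eqF ?sqrtr_gt0.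
Qed.

Lemma threshold_le (t x y : R) : x <= y -> threshold t x <= threshold t y.
Proof. by move=> xy; rewrite lerD2l ler_wpM2l// sqrtr_ge0. Qed.

(** The threshold at x is at least the random one, so an exceedance at a true hypothesis yields a
    small p-value; those at false hypotheses are covered by the added count. *)
Lemma exceedances_small_pvals n (t x : R) w : 0 < t < 1 -> X 0%N w <= x ->
  (exceedances n (threshold t x) w <= small_pvals n t w + false_hyps n)%N.
Proof.
move=> ht xx; rewrite -count_predUI; apply: leq_trans (leq_addr _ _).
apply: sub_count => i /= h; case tri: (tr n i); rewrite ?orbT//=.
rewrite orbF pval_le//; apply: le_trans h; exact: threshold_le.
Qed.

Lemma Vn_exceedances n x w : (0 < m n w)%N -> x <= X 0%N w ->
  (Vn alpha rho X tr n w <=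
    exceedances n (threshold ((m n w)%:R * alpha / n%:R) x) w)%N.
Proof.
move=> m0 xx; apply: sub_count => i /= /andP[tri]; rewrite /rejected pval_le//.
  by apply: le_trans; exact: threshold_le.
have n0 : (0 < n)%N by exact: leq_trans m0 (LSU_m_le n w).
rewrite divr_gt0 ?mulr_gt0 ?ltr0n//= ltr_pdivrMr ?ltr0n// mul1r.
apply: (@lt_le_trans _ _ (m n w)%:R); first by rewrite gtr_pMr// ltr0n.
by rewrite ler_nat LSU_m_le.
Qed.

Section measurability.
Hypothesis mX : forall i, measurable_fun setT (X i).

Lemma measurable_pval n i : measurable_fun setT (pv n i).
Proof.
rewrite /pval; case: (tr n i) => //.
apply: measurable_funB => //.
apply: (measurableT_comp (continuous_measurable_fun continuous_Phi)).
by apply: measurable_funB; apply: measurable_funM.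
Qed.

(** The maximum is at least k iff some j between k and n satisfies the step-up condition, and
    [small_pvals_LSU_m] supplies j = m. *)
Lemma measurable_LSU_m_ge n k : measurable [set w | (k <= m n w)%N].
Proof.
rewrite (_ : [set _ | _] = \bigcup_(j in [set j | (k <= j <= n)%N])
    [set w | (j <= small_pvals n (j%:R * alpha / n%:R) w)%N]).
  apply: bigcup_measurable => j _.
  apply: (@measurable_count_ge _ _ (fun i w => pv n i w <= _)) => i.
  rewrite (_ : [set _ | _] = pv n i @^-1` `]-oo, (j%:R * alpha / n%:R)%R]).
    by rewrite -[X in measurable X]setTI; apply: measurable_pval.
  by apply/seteqP; split=> w /=; rewrite in_itv.
apply/seteqP; split => w /=.
  move=> km; exists (m n w) => /=; first by rewrite km LSU_m_le.
  by rewrite small_pvals_LSU_m.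
by case=> j /= /andP[kj jn] /(LSU_m_ge _ _ _ jn); exact: leq_trans.
Qed.

Lemma measurable_LSU_m n (f : nat -> R) : measurable_fun setT (fun w => f (m n w)).
Proof.
move=> _ Y mY; rewrite setTI.
rewrite (_ : _ @^-1` Y = \bigcup_(k in [set k | Y (f k)])
    ([set w | (k <= m n w)%N] `\` [set w | (k.+1 <= m n w)%N])).
  by apply: bigcup_measurable => k _; apply: measurableD; exact: measurable_LSU_m_ge.
apply/seteqP; split => w /=.
  by move=> h; exists (m n w) => //=; split; rewrite ?leqnn ?ltnn.
case=> k /= h [h1 h2]; suff -> : m n w = k by [].
by apply/eqP; rewrite eqn_leq h1 andbT leqNgt; apply/negP.
Qed.

End measurability.
End step_up.

(** * Asymptotics of the number of rejections *)

Section with_high_probability.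
Context {R : realType} {d : measure_display} {T : measurableType d}.
Variable P : probability T R.

(* P (E n) --> 1, phrased so that E n need not be measurable. *)
Definition whp (E : nat -> set T) := forall e : R, 0 < e ->
  \forall n \near \oo, exists B, [/\ measurable B, (P B <= e%:E)%E & ~` B `<=` E n].

Lemma whpI E F : whp E -> whp F -> whp (fun n => E n `&` F n).
Proof.
move=> hE hF e e0; have e2 : 0 < e / 2 by rewrite divr_gt0.
near=> n.
have [B [mB PB BE]] : exists B, [/\ measurable B, (P B <= (e / 2)%:E)%E & ~` B `<=` E n].
  by near: n; exact: hE.
have [C [mC PC CF]] : exists B, [/\ measurable B, (P B <= (e / 2)%:E)%E & ~` B `<=` F n].
  by near: n; exact: hF.
exists (B `|` C); split; first exact: measurableU.
  by rewrite (le_trans (measureU2 _ mB mC))// [e in leRHS]splitr EFinD leeD.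
by rewrite setCU; exact: setISS.
Unshelve. all: by end_near. Qed.

Lemma whp_near E F : whp E -> (\forall n \near \oo, E n `<=` F n) -> whp F.
Proof.
move=> hE EF e e0; near=> n.
have [B [mB PB BE]] : exists B, [/\ measurable B, (P B <= e%:E)%E & ~` B `<=` E n].
  by near: n; exact: hE.
exists B; split => //; apply: subset_trans BE _.
by near: n.
Unshelve. all: by end_near. Qed.

Lemma whp_forall_lt (E : nat -> nat -> set T) M : (forall j, (j < M)%N -> whp (E j)) ->
  whp (fun n => [set w | forall j, (j < M)%N -> E j n w]).
Proof.
elim: M => [_|M IH hE].
  by move=> e e0; near=> n; exists set0; split; rewrite ?measure0 ?lee_fin ?ltW.
have := whpI _ _ (IH (fun j jM => hE j (ltnW jM))) (hE M (ltnSn M)).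
move/whp_near; apply; near=> n => w [h1 h2] j.
by rewrite ltnS leq_eqVlt => /orP[/eqP ->|/h1].
Unshelve. all: by end_near. Qed.

End with_high_probability.

(** * Integrals of quantities that drop from one to zero as X_0 passes a value *)

Section threshold_limit.
Context {R : realType} {dT : measure_display} {T : measurableType dT}.
Variables (P : probability T R) (X0 : {RV P >-> R}).
Hypothesis normalX0 : distribution P X0 = normal_prob 0 1 :> (set R -> \bar R).

Lemma normal_cdf y : P [set w | X0 w <= y] = (Phi y)%:E.
Proof.
by rewrite PhiE -normalX0 /distribution/=; congr (P _).
Qed.

Lemma measurable_RV_le y : measurable [set w | X0 w <= y].
Proof.
rewrite (_ : [set _ | _] = setT `&` X0 @^-1` `]-oo, y]).
  by apply: measurable_funP => //; exact: measurable_itv.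
by rewrite setTI; apply/seteqP; split => w /=; rewrite in_itv.
Qed.

Lemma indic_ge0_EFin (A : set T) w : (0 <= (\1_A w : R)%:E)%E.
Proof. by rewrite lee_fin. Qed.

(** Up to small errors and small events, W n lies between the indicators of X_0 <= xi - r/2 and X_0
    <= xi + r/2; continuity of [Phi] at xi closes the gap. *)
Lemma cvg_integral_threshold (W : nat -> T -> R) (xi : R) :
  (forall n, measurable_fun setT (W n)) -> (forall n w, 0 <= W n w <= 1) ->
  (forall y e : R, y < xi -> 0 < e -> whp P (fun n => [set w | X0 w <= y -> 1 - e <= W n w])) ->
  (forall y e : R, xi < y -> 0 < e -> whp P (fun n => [set w | y <= X0 w -> W n w <= e])) ->
  (\int[P]_w (W n w)%:E)%E @[n --> \oo] --> (Phi xi)%:E.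
Proof.
move=> mW W01 lower upper.
have mWE n : measurable_fun setT (fun w => (W n w)%:E) by exact/measurable_EFinP.
have W0 n w : (0 <= (W n w)%:E)%E by rewrite lee_fin; case/andP: (W01 n w).
have mI (A : set T) : measurable A -> measurable_fun setT (fun w => (\1_A w : R)%:E).
  by move=> mA; apply/measurable_EFinP; exact: measurable_indic.
have intI (A : set T) : measurable A -> (\int[P]_w (\1_A w : R)%:E = P A)%E.
  by move=> mA; rewrite integral_indic// setIT.
have fin n : (\int[P]_w (W n w)%:E)%E \is a fin_num.
  rewrite ge0_fin_numE ?integral_ge0//.
  apply: (@le_lt_trans _ _ (\int[P]_w (cst 1 w))%E).
    by apply: ge0_le_integral => // w _; rewrite lee_fin; case/andP: (W01 n w).
  by rewrite integral_cst// mul1e (le_lt_trans (probability_le1 P measurableT))// ltry.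
apply: cvg_EFin; first by near=> n; exact: fin.
apply/cvgrPdist_lt => e e0.
(* On either side three errors of at most e3 add up: from the continuity of [Phi], from the
   exceptional event, and from W. The bound 1/2 keeps 1 - e3 nonnegative. *)
pose e3 := Num.min (e / 4) (1 / 2).
have e30 : 0 < e3 by rewrite lt_min !divr_gt0.
have e3e : e3 <= e / 4 by rewrite ge_min lexx.
have e31 : e3 <= 1 / 2 by rewrite ge_min lexx orbT.
have /cvgrPdist_lt/(_ e3 e30) := continuous_Phi xi.
move=> /nbhs_ballP[r /= r0 hr].
have near_Phi y : `|xi - y| < r -> `|Phi xi - Phi y| < e3 by move=> h; exact: hr.
have r2 : 0 < r / 2 by rewrite divr_gt0.
have yl : `|Phi xi - Phi (xi - r / 2)| < e3.
  by apply: near_Phi; rewrite subKr gtr0_norm// ltr_pdivrMr// ltr_pMr// ltr1n.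
have yu : `|Phi xi - Phi (xi + r / 2)| < e3.
  by apply: near_Phi; rewrite opprD addNKr normrN gtr0_norm// ltr_pdivrMr// ltr_pMr// ltr1n.
near=> n.
have [B [mB PB hB]] : exists B, [/\ measurable B, (P B <= e3%:E)%E &
    ~` B `<=` [set w | X0 w <= xi - r / 2 -> 1 - e3 <= W n w]].
  by near: n; apply: lower => //; rewrite gtrBl.
have [C [mC PC hC]] : exists B, [/\ measurable B, (P B <= e3%:E)%E &
    ~` B `<=` [set w | xi + r / 2 <= X0 w -> W n w <= e3]].
  by near: n; apply: upper => //; rewrite ltrDl.
rewrite /=; set I := fine _.
have IE : (\int[P]_w (W n w)%:E)%E = I%:E by rewrite fineK.
have fB : P B = (fine (P B))%:E by rewrite fineK// fin_num_measure.
have fC : P C = (fine (P C))%:E by rewrite fineK// fin_num_measure.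
(* Pointwise, (1 - e3) times the indicator of A is at most W plus the indicator of the exceptional
   event B. *)
have lo : (1 - e3) * Phi (xi - r / 2) <= I + e3.
  set A := [set w | X0 w <= xi - r / 2].
  have mA : measurable A by exact: measurable_RV_le.
  have : (\int[P]_w ((1 - e3)%:E * (\1_A w : R)%:E) <=
      \int[P]_w ((W n w)%:E + (\1_B w : R)%:E))%E.
    apply: ge0_le_integral => //.
    - by move=> w _; rewrite mule_ge0// lee_fin; lra.
    - by apply: measurable_funeM; exact: mI.
    - by apply: emeasurable_funD => //; exact: mI.
    move=> w _; rewrite -EFinM -EFinD lee_fin !indicE.
    have /andP[w0 _] := W01 n w.
    have [wB|/negP wB] := boolP (w \in B).
      by case: (_ \in A); rewrite /= ?mulr1 ?mulr0; lra.
    have := hB w; rewrite /= inE in wB => /(_ wB) h.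
    have [|_] := boolP (w \in A); last by rewrite mulr0 addr0.
    by rewrite inE => /h; rewrite mulr1 addr0.
  rewrite ge0_integralZl//; [|exact: mI|by rewrite lee_fin; lra].
  rewrite ge0_integralD//; [|exact: mI].
  rewrite !intI// normal_cdf IE -EFinM fB -EFinD lee_fin => h.
  by apply: (le_trans h); rewrite lerD2l -lee_fin -fB.
have up : I <= Phi (xi + r / 2) + e3 + e3.
  set A := [set w | X0 w <= xi + r / 2].
  have mA : measurable A by exact: measurable_RV_le.
  have : (\int[P]_w (W n w)%:E <=
      \int[P]_w (((\1_A w : R)%:E + (\1_C w : R)%:E) + cst e3%:E w))%E.
    apply: ge0_le_integral => //.
    - by apply: emeasurable_funD => //; apply: emeasurable_funD; exact: mI.
    move=> w _; rewrite -!EFinD lee_fin !indicE.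
    have /andP[w0 w1] := W01 n w.
    have [wC|/negP wC] := boolP (w \in C).
      by case: (_ \in A); rewrite /=; lra.
    have := hC w; rewrite /= inE in wC => /(_ wC) h.
    have [|/negP] := boolP (w \in A); first by move=> _ /=; lra.
    by rewrite inE /A /= => /negP; rewrite -ltNge => /ltW/h /=; lra.
  rewrite ge0_integralD//=; last 3 first.
    by move=> w _; apply: adde_ge0; exact: indic_ge0_EFin.
    by apply: emeasurable_funD; exact: mI.
    by move=> _ _; rewrite lee_fin ltW.
  rewrite ge0_integralD//; [|exact: mI|exact: mI].
  rewrite integral_cst//= probability_setT mule1.
  rewrite !intI// normal_cdf IE fC -!EFinD lee_fin => h.
  by apply: (le_trans h); rewrite lerD2r lerD2l -lee_fin -fC.
have P1 := Phi_lt1 (xi - r / 2).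
have P0 := Phi_gt0 (xi - r / 2).
move: yl yu; rewrite !ltr_norml => /andP[l1 l2] /andP[u1 u2].
have : e3 * Phi (xi - r / 2) <= e3 * 1 by rewrite ler_pM2l// ltW.
move: lo; rewrite mulrBl mul1r mulr1 => lo h.
clear -l1 l2 u1 u2 lo up h e3e e30.
apply/andP; split; lra.
Unshelve. all: by end_near. Qed.

End threshold_limit.

(** * High-probability bounds on the numbers of rejections *)

Section LSU_limits.
Context {R : realType} {dT : measure_display} {T : measurableType dT}.
Variables (P : probability T R) (alpha rho : R).
Variables (X : nat -> {RV P >-> R}) (tr : nat -> nat -> bool).
Hypotheses (alpha01 : 0 < alpha < 1) (rho01 : 0 < rho < 1).
Hypothesis normalX :
  forall i, distribution P (X i) = normal_prob 0 1 :> (set R -> \bar R).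
Hypothesis indepX : mutually_independent P (fun i => (X i : T -> R)).
Hypothesis zeta1 : zeta tr n @[n --> \oo] --> (1 : R).

Local Notation Xf := (fun i => (X i : T -> R)).
Local Notation slope := (Num.sqrt (rhobar rho))^-1.
Local Notation load := (Num.sqrt (rho / rhobar rho)).
Local Notation m := (LSU_m alpha rho Xf tr).
Local Notation V := (Vn alpha rho Xf tr).
Local Notation thr := (threshold rho).
Local Notation exc := (exceedances Xf).
Local Notation d := (dfun alpha rho).
Local Notation whp := (whp P).

Let a0 : 0 < alpha. Proof. by case/andP: alpha01. Qed.
Let a1 : alpha < 1. Proof. by case/andP: alpha01. Qed.

Lemma exceedancesE n y w :
  (exc n y w)%:R = (\sum_(i < n) (\1_(X i.+1 @^-1` `[y, +oo[) : T -> R)) w :> R.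
Proof.
elim: n => [|n IH]; first by rewrite big_ord0.
rewrite big_ord_recr/= /exceedances.
have -> : iota 1 n.+1 = iota 1 n ++ [:: n.+1] by rewrite -[X in iota 1 X]addn1 iotaD.
rewrite count_cat natrD IH.
suff -> : (count (fun i => y <= X i w) [:: n.+1])%:R =
  (\1_(X n.+1 @^-1` `[y, +oo[) : T -> R) w by [].
rewrite /= addn0 indicE; congr (nat_of_bool _)%:R.
by apply/idP/idP; rewrite inE/= in_itv/= andbT.
Qed.

Lemma exceedances_deviation n y (delta : R) : 0 < delta ->
  let B := [set w | delta <= `|(exc n y w)%:R - n%:R * (1 - Phi y)|] in
  measurable B /\ (P B <= (n%:R * (1 - Phi y) / delta ^+ 2)%:E)%E.
Proof.
move=> d0; pose A i := X i.+1 @^-1` `[y, +oo[.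
have mA i : measurable (A i) by rewrite /A -[X in measurable X]setTI; exact: measurable_funP.
have PA i : P (A i) = (1 - Phi y)%:E.
  by rewrite -normal_prob_itvcy -(normalX i.+1).
have iA i j : i != j -> (P (A i `&` A j) = P (A i) * P (A j))%E.
  move=> ij; have := indepX [:: i.+1; j.+1] (fun _ => `[y, +oo[%classic).
  rewrite !big_cons big_nil mule1 /= inE eqSS ij /= => /(_ isT) <-.
    congr (P _); apply/seteqP; split => w /=.
      by move=> [h1 h2] k /=; rewrite !inE => /orP[]/eqP ->.
    by move=> h; split; apply: h; rewrite /= !inE eqxx ?orbT.
  by move=> _; exact: measurable_itv.
have -> : [set w | delta <= `|(exc n y w)%:R - n%:R * (1 - Phi y)|] =
    [set w | delta <= `|(\sum_(i < n) (\1_(A i) : T -> R)) w - n%:R * (1 - Phi y)|].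
  by apply/seteqP; split => w /=; rewrite exceedancesE.
split; last exact: (chebyshev_count _ _ _ mA PA iA).
have mS := measurable_count P A mA n.
pose F w := `|(\sum_(i < n) (\1_(A i) : T -> R)) w - n%:R * (1 - Phi y)|.
have mF : measurable_fun setT F.
  by apply: measurableT_comp => //; apply: measurable_funB.
rewrite (_ : [set w | _] = setT `&` F @^-1` `[delta, +oo[); first exact: mF.
by rewrite setTI; apply/seteqP; split => w /=; rewrite in_itv/= andbT.
Qed.

Lemma near_natr_ge (K : R) : \forall n \near \oo, K <= n%:R.
Proof. exact: nbhs_infty_ger. Qed.

Lemma whp_exceedances y (c : R) : 0 < c ->
  whp (fun n => [set w | `|(exc n y w)%:R - n%:R * (1 - Phi y)| < c * n%:R]).
Proof.
move=> c0 e e0; near=> n.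
have n0 : 0 < n%:R :> R.
  by rewrite (lt_le_trans ltr01)//; near: n; exact: near_natr_ge.
have cn0 : 0 < c * n%:R by rewrite mulr_gt0.
have [mB PB] := exceedances_deviation n y _ cn0.
eexists; split; [exact: mB| |by move=> w /= /negP; rewrite -ltNge].
apply: (le_trans PB); rewrite lee_fin.
rewrite (_ : _ / _ = (1 - Phi y) / (c ^+ 2) / n%:R); last first.
  by field; rewrite !gt_eqF.
rewrite ler_pdivrMr// -ler_pdivrMl//.
by near: n; exact: near_natr_ge.
Unshelve. all: by end_near. Qed.

Lemma near_false_hyps (c : R) : 0 < c ->
  \forall n \near \oo, (false_hyps tr n)%:R < c * n%:R.
Proof.
move=> c0; near=> n.
have n0 : (0 < n)%N.
  by rewrite -(ltr0n R) (lt_le_trans ltr01)//; near: n; exact: near_natr_ge.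
have : 1 - c < zeta tr n.
  by near: n; apply: (cvgr_gt (1 : R) zeta1); rewrite gtrBl.
by rewrite zetaE// ltrD2l ltrN2 ltr_pdivrMr ?ltr0n.
Unshelve. all: by end_near. Qed.

Lemma alphaM01 (s : R) : 0 < s <= 1 -> 0 < alpha * s < 1.
Proof.
move=> /andP[s0 s1]; rewrite mulr_gt0//= (le_lt_trans _ a1)//.
by rewrite ger_pMr.
Qed.

(** The left side is F_oo(alpha s | y0), so [dfun] measures its distance from the line. *)
Lemma exceed_prob (s y0 : R) : 0 < s <= 1 ->
  1 - Phi (thr (alpha * s) y0) = s + d (Phiinv (1 - alpha * s)) y0.
Proof.
move=> hs; rewrite /dfun /threshold onem_PhiinvK ?alphaM01//.
by rewrite [alpha * s]mulrC mulfK ?gt_eqF// [RHS]addrC subrK (mulrC _^-1).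
Qed.

Lemma threshold_anti (s t x : R) : 0 < s -> s <= t -> t < 1 ->
  thr t x <= thr s x.
Proof.
move=> s0 st t1; rewrite lerD2r ler_wpM2l ?invr_ge0 ?sqrtr_ge0//.
have hs : 0 < s < 1 by rewrite s0 (le_lt_trans st).
have ht : 0 < t < 1 by rewrite t1 (lt_le_trans s0).
by rewrite Phiinv_le ?onem01// PhiinvK ?onem01// lerD2l lerN2.
Qed.

Lemma exceedances_anti n y z w : y <= z -> (exc n z w <= exc n y w)%N.
Proof. by move=> yz; apply: sub_count => i /=; exact: le_trans. Qed.

Lemma LSU_level n w : (0 < m n w)%N -> 0 < ((m n w)%:R / n%:R : R) <= 1.
Proof.
move=> m0; have n0 : (0 < n)%N by exact: leq_trans m0 (LSU_m_le _ _ _ _ n w).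
by rewrite divr_gt0 ?ltr0n//= ler_pdivrMr ?ltr0n// mul1r ler_nat LSU_m_le.
Qed.

Lemma Vn_exceedances_level n x0 (s : R) w : (0 < m n w)%N -> x0 <= X 0%N w ->
  (m n w)%:R / n%:R <= s -> alpha * s < 1 ->
  (V n w <= exc n (thr (alpha * s) x0) w)%N.
Proof.
move=> m0 xx ms as1; apply: leq_trans (Vn_exceedances _ _ Xf _ alpha01 rho01 n x0 w m0 xx) _.
apply: exceedances_anti; rewrite (mulrC (m n w)%:R) -mulrA.
have /andP[l0 l1] := LSU_level n w m0.
by apply: threshold_anti => //; [rewrite mulr_gt0|rewrite ler_wpM2l// ltW].
Qed.

(** About n (s + dd) exceedances, less o(n) at false hypotheses, leave more than n s small p-values,
    so that the step-up condition holds at the integer just above n s. *)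
Lemma whp_LSU_ge (s y0 : R) : 0 < s < 1 -> 0 < d (Phiinv (1 - alpha * s)) y0 ->
  whp (fun n => [set w | X 0%N w <= y0 -> n%:R * s < (m n w)%:R]).
Proof.
move=> /andP[s0 s1] dpos; have s01 : 0 < s <= 1 by rewrite s0 ltW.
(* One third of dd each for the deviation of the count, the false hypotheses and the rounding of n
   s. *)
set dd := d _ _ in dpos; have c0 : 0 < dd / 3 by rewrite divr_gt0.
apply: (whp_near _ _ _ (whp_exceedances (thr (alpha * s) y0) _ c0)).
near=> n => w /=; rewrite exceed_prob// -/dd => h xy.
have hF : (false_hyps tr n)%:R < dd / 3 * n%:R by near: n; exact: near_false_hyps.
have hn : 1 <= dd / 3 * n%:R.
  by rewrite mulrC -ler_pdivrMr//; near: n; exact: near_natr_ge.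
have hsp := exceedances_small_pvals rho Xf tr rho01 n (alpha * s) y0 w (alphaM01 _ s01) xy.
have {}hsp : (exc n (thr (alpha * s) y0) w)%:R <=
    (small_pvals rho Xf tr n (alpha * s) w)%:R + (false_hyps tr n)%:R :> R.
  by rewrite -natrD ler_nat.
move: h; rewrite ltr_norml => /andP[h _].
have n0 : 0 < n%:R :> R by rewrite -(pmulr_rgt0 _ c0) (lt_le_trans ltr01).
pose k := (Num.truncn (n%:R * s)).+1.
have ks : n%:R * s < k%:R by exact: truncnS_gt.
have kle : k%:R <= n%:R * s + 1.
  by rewrite /k -natr1 lerD2r truncn_le mulr_ge0 ?ltW.
have kN : (k <= small_pvals rho Xf tr n (alpha * s) w)%N.
  rewrite -(ler_nat R); lra.
apply: (lt_le_trans ks); rewrite ler_nat; apply: LSU_m_ge.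
  exact: leq_trans kN (small_pvals_le _ _ _ _ _ _).
apply: leq_trans kN _; apply: small_pvals_mono.
by rewrite ler_pdivlMr// mulrC mulrCA mulrC ler_wpM2r ?ltW.
Unshelve. all: by end_near. Qed.

(** Levels in [s, 1] correspond to a compact interval of u, on which the continuous [dfun] attains a
    negative maximum. *)
Lemma dfun_away (s y0 : R) : 0 < s < 1 ->
  (forall u, u <= Phiinv (1 - alpha * s) -> d u y0 < 0) ->
  exists2 c, 0 < c & forall s', s <= s' <= 1 ->
    1 - Phi (thr (alpha * s') y0) <= s' - c.
Proof.
move=> /andP[s0 s1] dneg; have s01 : 0 < s <= 1 by rewrite s0 ltW.
have one01 : 0 < (1 : R) <= 1 by rewrite ltr01 lexx.
set ub := Phiinv _ in dneg; set ua := Phiinv (1 - alpha * 1).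
have le_u s' : 0 < s' <= 1 -> s <= s' -> Phiinv (1 - alpha * s') <= ub.
  move=> hs' ss'; rewrite Phiinv_le ?onem01 ?alphaM01// /ub PhiinvK ?onem01 ?alphaM01//.
  by rewrite lerD2l lerN2 ler_wpM2l// ltW.
have ge_u s' : 0 < s' <= 1 -> ua <= Phiinv (1 - alpha * s').
  move=> hs'; rewrite Phiinv_le ?onem01 ?alphaM01// PhiinvK ?onem01 ?alphaM01//.
  by rewrite lerD2l lerN2 ler_wpM2l ?(ltW a0)//; case/andP: hs'.
have ab : ua <= ub by exact: ge_u.
have cont : {within `[ua, ub], continuous (d ^~ y0)}.
  exact/continuous_subspaceT/continuous_dfun.
have [c cab cmax] := EVT_max ab cont.
exists (- d c y0).
  by rewrite oppr_gt0 dneg//; move: cab; rewrite in_itv/= => /andP[].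
move=> s' /andP[ss' s'1]; have hs' : 0 < s' <= 1 by rewrite s'1 (lt_le_trans s0).
rewrite exceed_prob// opprK lerD2l cmax// in_itv/= ge_u//=.
exact: le_u.
Qed.

(** The random level m/n is caught between neighbours of a finite grid on [s, 1]. At the upper
    neighbour V is bounded by a count at a fixed threshold, which with the false hypotheses is too
    small to reach m. *)
Lemma whp_LSU_le (s y0 : R) : 0 < s < 1 ->
  (forall u, u <= Phiinv (1 - alpha * s) -> d u y0 < 0) ->
  whp (fun n => [set w | y0 <= X 0%N w -> (m n w)%:R <= n%:R * s]).
Proof.
move=> hs dneg; have [c c0 hc] := dfun_away _ _ hs dneg.
have /andP[s0 s1] := hs.
(* Mesh width, deviation and false hypotheses cost at most c/4 each, together less than c. *)
have c4 : 0 < c / 4 by rewrite divr_gt0.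
pose M := (Num.truncn (4 / c)).+1; have M0 : 0 < M%:R :> R by rewrite ltr0n.
have Mc : M%:R^-1 <= c / 4.
  by rewrite -invf_div lef_pV2 ?posrE ?divr_gt0// ltW ?truncnS_gt.
pose g j := s + j%:R / M%:R * (1 - s).
have g_step j : g j.+1 <= g j + c / 4.
  rewrite /g -natr1 mulrDl mulrDl addrA lerD2l mul1r (le_trans _ Mc)//.
  by rewrite ger_pMr ?invr_gt0// gerBl ltW.
have gM : g M = 1 by rewrite /g divff ?gt_eqF// mul1r addrC subrK.
have g0 : g 0%N = s by rewrite /g !mul0r addr0.
have g_ge j : s <= g j.
  by rewrite /g lerDl mulr_ge0 ?subr_ge0 ?(ltW s1)// divr_ge0.
have g_le j : (j <= M)%N -> g j <= 1.
  move=> jM; rewrite -gM lerD2l ler_wpM2r ?subr_ge0 ?(ltW s1)//.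
  by rewrite ler_wpM2r ?invr_ge0 ?ler_nat// ltW.
have := whp_forall_lt _ _ M.+1
  (fun j _ => whp_exceedances (thr (alpha * g j) y0) _ c4).
move/whp_near; apply; near=> n => w /= h yx.
have hF : (false_hyps tr n)%:R < c / 4 * n%:R by near: n; exact: near_false_hyps.
have n0 : 0 < n%:R :> R.
  by rewrite (lt_le_trans ltr01)//; near: n; exact: near_natr_ge.
rewrite leNgt; apply/negP => sm.
have m0 : (0 < m n w)%N by rewrite -(ltr0n R) (lt_trans _ sm)// mulr_gt0.
have /andP[_ l1] := LSU_level n w m0.
have sl : s < (m n w)%:R / n%:R by rewrite ltr_pdivlMr// mulrC.
have exj : exists j, (m n w)%:R / n%:R <= g j by exists M; rewrite gM.
case: (ex_minnP exj) => j hj jmin.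
have jM : (j <= M)%N by apply: jmin; rewrite gM.
(* The least grid point above m/n is not the first one, as g 0 = s < m/n; hence it has a predecessor
   below m/n. *)
case: j hj jmin jM => [|j] hj jmin jM; first by move: hj; rewrite g0 leNgt sl.
have gj : g j < (m n w)%:R / n%:R.
  by rewrite ltNge; apply/negP => /jmin; rewrite ltnn.
have gj01 : 0 < g j.+1 <= 1 by rewrite g_le// andbT (lt_le_trans s0).
have aj : alpha * g j.+1 < 1 by case/andP: (alphaM01 _ gj01).
have hV := Vn_exceedances_level n y0 _ w m0 yx hj aj.
have {}hV : (V n w)%:R <= (exc n (thr (alpha * g j.+1) y0) w)%:R :> R by rewrite ler_nat.
have VF : (V n w)%:R + (false_hyps tr n)%:R = (m n w)%:R :> R.
  by rewrite -natrD VnE.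
have := h j.+1; rewrite ltnS => /(_ jM); rewrite ltr_norml => /andP[_ hE].
have : 1 - Phi (thr (alpha * g j.+1) y0) <= g j + c / 4 - c.
  by rewrite (le_trans (hc (g j.+1) _)) ?lerD2r// g_ge g_le.
rewrite -(ler_pM2l n0) => hP.
move: gj; rewrite ltr_pdivlMr// => gj; nra.
Unshelve. all: by end_near. Qed.

Lemma threshold_PhiE (u x : R) : thr (1 - Phi u) x = slope * u + load * x.
Proof. by rewrite /threshold subKr PhiK. Qed.

(** If 2^j <= m < 2^(j+1), then V is at most the count at the level of 2^(j+1), whose mean is small
    against 2^j by [dfun_tail]. By Chebyshev, that count exceeds eps 2^j with probability of order
    2^-j. *)
Lemma whp_Vn_le (eps y0 : R) : 0 < eps -> (forall u, d u y0 < 0) ->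
  whp (fun n => [set w | y0 <= X 0%N w -> (V n w)%:R <= eps * (m n w)%:R]).
Proof.
move=> eps0 dneg e e0.
(* The first bound makes the mean, at most 2 eta 2^j, no more than half of eps 2^j; the second turns
   the Chebyshev bound 8 eta / (eps^2 2^j) into (e/4) / 2^j. *)
pose eta := Num.min (eps / 4) (e * eps ^+ 2 / 32).
have eta0 : 0 < eta by rewrite lt_min !divr_gt0// mulr_gt0// exprn_gt0.
have eta_eps : eta <= eps / 4 by rewrite ge_min lexx.
have eta_e : eta <= e * eps ^+ 2 / 32 by rewrite ge_min lexx orbT.
have [A hA] := dfun_tail rho rho01 eta (load * y0) eta0.
(* Blocks with 2^j <= n s then have level at most 1 - Phi A, where [dfun_tail] applies. *)
pose s := (1 - Phi A) / 4.
have /andP[tA0 tA1] := onem_Phi01 A.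
have s0 : 0 < s by rewrite divr_gt0.
have s1 : s < 1 by rewrite /s; lra.
have s01 : 0 < s < 1 by rewrite s0.
have e2 : 0 < e / 2 by rewrite divr_gt0.
pose t n j := alpha * ((2 ^ j.+1)%:R / n%:R) : R.
have pow_gt0 j : 0 < (2 ^ j)%:R :> R by rewrite ltr0n expn_gt0.
have powS j : (2 ^ j.+1)%:R = 2 * (2 ^ j)%:R :> R by rewrite expnS natrM.
(* Blocks beyond n s get the empty event, because m <= n s off the event [B1] when X_0 >= y0. *)
pose B n j := if (2 ^ j)%:R <= n%:R * s then
  [set w | eps * (2 ^ j)%:R / 2 <=
     `|(exc n (thr (t n j) y0) w)%:R - n%:R * (1 - Phi (thr (t n j) y0))|]
  else set0.
have dev0 j : 0 < eps * (2 ^ j)%:R / 2 by rewrite divr_gt0// mulr_gt0.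
have level n j : (0 < n)%N -> (2 ^ j)%:R <= n%:R * s ->
    0 < t n j < 1 /\ n%:R * (1 - Phi (thr (t n j) y0)) <= eta * (2 * (2 ^ j)%:R).
  move=> n0 jn; have n0' : 0 < n%:R :> R by rewrite ltr0n.
  have t0 : 0 < t n j by rewrite mulr_gt0// divr_gt0.
  have tA : t n j <= 1 - Phi A.
    rewrite /t mulrA ler_pdivrMr// powS.
    have : alpha * (2 * (2 ^ j)%:R) <= 1 * (2 * (2 ^ j)%:R).
      by rewrite ler_wpM2r ?(ltW a1)// mulr_ge0// ltW.
    move=> h; apply: (le_trans h); rewrite mul1r.
    have : 2 * (2 ^ j)%:R <= 2 * (n%:R * s) by rewrite ler_pM2l.
    move=> h'; apply: (le_trans h'); rewrite /s; nra.
  have t01 : 0 < t n j < 1 by rewrite t0 (le_lt_trans tA).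
  split => //; rewrite -{1}(onem_PhiinvK _ t01) threshold_PhiE.
  have hu : A <= Phiinv (1 - t n j).
    rewrite Phiinv_ge ?onem01//.
    by rewrite lerBrDr addrC -lerBrDr.
  apply: (le_trans (ler_wpM2l (ltW n0') (hA _ hu))).
  rewrite onem_PhiinvK// mulrCA ler_pM2l// /t powS.
  rewrite (_ : _ * (alpha * _) = alpha * (2 * (2 ^ j)%:R)).
    by rewrite ger_pMl ?(ltW a1)// mulr_gt0.
  by field; rewrite gt_eqF.
have mB n j : (0 < n)%N -> measurable (B n j) /\ (P (B n j) <= (e / 4 / (2 ^ j)%:R)%:E)%E.
  move=> n0; rewrite /B; case: ifPn => jn; last first.
    by split => //; rewrite measure0 lee_fin !divr_ge0 ?ltW.
  have [_ hq] := level _ _ n0 jn.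
  have [mB PB] := exceedances_deviation n (thr (t n j) y0) _ (dev0 j).
  split => //; apply: (le_trans PB); rewrite lee_fin ler_pdivrMr ?exprn_gt0//.
  apply: (le_trans hq).
  rewrite (_ : _ * _ ^+ 2 = e * eps ^+ 2 / 32 * (2 * (2 ^ j)%:R)); last first.
    by field; rewrite gt_eqF.
  by rewrite ler_wpM2r// mulr_ge0// ltW.
near=> n.
have n0 : (0 < n)%N.
  by rewrite -(ltr0n R) (lt_le_trans ltr01)//; near: n; exact: near_natr_ge.
have [B1 [mB1 PB1 hB1]] : exists B, [/\ measurable B, (P B <= (e / 2)%:E)%E &
    ~` B `<=` [set w | y0 <= X 0%N w -> (m n w)%:R <= n%:R * s]].
  near: n; apply: (whp_LSU_le) => //.
pose B2 := \big[setU/set0]_(j < n) B n j.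
have mB2 : measurable B2 by apply: bigsetU_measurable => j _; case: (mB n j n0).
have PB2 : (P B2 <= (e / 2)%:E)%E.
  apply: (@le_trans _ _ (\sum_(j < n) P (B n j))%E).
    by apply: (content_subadditive P) => // j _; case: (mB n j n0).
  apply: (@le_trans _ _ (\sum_(j < n) (e / 4 / (2 ^ j)%:R)%:E)%E).
    by apply: lee_sum => j _; case: (mB n j n0).
  rewrite sumEFin lee_fin.
  suff -> : \sum_(j < n) e / 4 / (2 ^ j)%:R = e / 2 * (1 - (2 ^ n)%:R^-1).
    by rewrite ger_pMr// gerBl invr_ge0 ltW.
  elim: (n) => [|k IH]; first by rewrite big_ord0 expn0 invr1 subrr mulr0.
  rewrite big_ord_recr/= IH powS.
  by field; rewrite gt_eqF.
exists (B1 `|` B2); split; first exact: measurableU.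
  by rewrite (le_trans (measureU2 _ mB1 mB2))// [e in leRHS]splitr EFinD leeD.
rewrite setCU => w [wB1 wB2] /= yx.
have {hB1} ms := hB1 w wB1 yx.
have [m0|m0] := posnP (m n w).
  have := VnE alpha rho Xf tr alpha01 n w; rewrite m0 => /eqP.
  by rewrite addn_eq0 => /andP[/eqP -> _]; rewrite mulr0.
have [j /andP[j1 j2]] : exists j, (2 ^ j <= m n w < 2 ^ j.+1)%N.
  by exists (trunc_log 2 (m n w)); exact: trunc_log_bounds.
(* Since j < 2^j <= m <= n, the n blocks united in [B2] suffice. *)
have jn : (j < n)%N.
  by rewrite (leq_trans (ltn_expl j (isT : (1 < 2)%N)))// (leq_trans j1)// LSU_m_le.
have j1' : (2 ^ j)%:R <= (m n w)%:R :> R by rewrite ler_nat.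
have js : (2 ^ j)%:R <= n%:R * s by exact: le_trans j1' ms.
have [/andP[_ tj1] hq] := level _ _ n0 js.
have hV : (V n w <= exc n (thr (t n j) y0) w)%N.
  apply: (Vn_exceedances_level) => //.
  by rewrite ler_wpM2r ?invr_ge0// ler_nat ltnW.
have {}hV : (V n w)%:R <= (exc n (thr (t n j) y0) w)%:R :> R by rewrite ler_nat.
have : ~ B n j w.
  by move=> h; apply: wB2; rewrite /B2 -bigcup_mkord; exists j.
rewrite /B js => /negP; rewrite -ltNge ltr_norml => /andP[_ h].
have h' : eta * (2 * (2 ^ j)%:R) <= eps / 4 * (2 * (2 ^ j)%:R).
  by rewrite ler_wpM2r// mulr_ge0// ltW.
have : eps * (2 ^ j)%:R <= eps * (m n w)%:R by rewrite ler_pM2l.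
lra.
Unshelve. all: by end_near. Qed.

(** * Rejections on either side of the tangent value, and the FDR *)

Variable x0s : R.
Hypothesis tangent : tangent_point alpha rho x0s.
Local Notation uc := (u2 alpha rho x0s).
Local Notation t2 := (1 - Phi uc).
Local Notation a := (t2 / alpha).
Local Notation F := (false_hyps tr).

Lemma crit_level01 : 0 < a < 1.
Proof.
rewrite divr_gt0 ?subr_gt0 ?Phi_lt1//= ltr_pdivrMr// mul1r.
exact: t2_lt_alpha.
Qed.

Lemma x0t_above t : t2 < t < alpha ->
  [/\ d (Phiinv (1 - t)) (x0t alpha rho t) = 0, Phiinv (1 - t) < uc &
      x0t alpha rho t < x0s].
Proof.
move=> /andP[t2t ta]; have /andP[a_0 _] := crit_level01.
have t20 : 0 < t2 by rewrite subr_gt0 Phi_lt1.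
have t01 : 0 < t < 1 by rewrite (lt_trans t20) ?(lt_trans ta).
have dt : d (Phiinv (1 - t)) (x0t alpha rho t) = 0.
  by apply: dfun_x0t => //; rewrite (lt_trans t20).
have ut : Phiinv (1 - t) < uc by rewrite Phiinv_lt ?onem01// ltrBlDr addrC -ltrBlDr.
by split => //; exact: (dfun_zero_lt _ _ alpha01 rho01 _ tangent _ _ ut dt).
Qed.

(** At X_0 = [x0t] t, the point belonging to s lies between the zero and [uc], where [dfun] is
    positive; as [dfun] decreases in x, it vanishes there only for a larger x. *)
Lemma x0t_decr s t : t2 < s -> s < t -> t < alpha ->
  x0t alpha rho t < x0t alpha rho s.
Proof.
move=> t2s st ta.
have [dt ut _] : [/\ d (Phiinv (1 - t)) (x0t alpha rho t) = 0, Phiinv (1 - t) < uc &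
    x0t alpha rho t < x0s] by apply: x0t_above; rewrite (lt_trans t2s).
have [ds us _] : [/\ d (Phiinv (1 - s)) (x0t alpha rho s) = 0, Phiinv (1 - s) < uc &
    x0t alpha rho s < x0s] by apply: x0t_above; rewrite t2s (lt_trans st).
have t20 : 0 < t2 by rewrite subr_gt0 Phi_lt1.
have t01 : 0 < t < 1 by rewrite (lt_trans t20) ?(lt_trans _ st) ?(lt_trans ta).
have s01 : 0 < s < 1 by rewrite (lt_trans t20) ?(lt_trans st) ?(lt_trans ta).
have [_ hpos] := dfun_zero_cross _ _ alpha01 rho01 _ tangent _ _ ut dt.
have : 0 < d (Phiinv (1 - s)) (x0t alpha rho t).
  apply: hpos; last exact: ltW.
  by rewrite Phiinv_lt ?onem01// PhiinvK ?onem01// ltrD2l ltrN2.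
rewrite ltNge => h; rewrite ltNge; apply/negP => h'; apply: (negP h).
move: h'; rewrite le_eqVlt => /orP[/eqP <-|]; first by rewrite ds.
by move/(dfun_decr alpha rho rho01 (Phiinv (1 - s))); rewrite ds => /ltW.
Qed.

Lemma VnB n w : (V n w)%:R = (m n w)%:R - (F n)%:R :> R.
Proof. by rewrite -(VnE alpha rho Xf tr alpha01 n w) natrD addrK. Qed.

Lemma mX i : measurable_fun setT (Xf i).
Proof. exact: measurable_funPT. Qed.

Lemma whp_LSU_crit y : y < x0s -> whp (fun n => [set w | X 0%N w <= y -> n%:R * a < (m n w)%:R]).
Proof.
move=> yx; apply: whp_LSU_ge => //; first exact: crit_level01.
rewrite mulrC divfK ?gt_eqF// subKr PhiK.
exact: (dfun_crit_gt0 _ _ rho01 _ tangent).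
Qed.

Lemma whp_LSU_small y (s : R) : x0s < y -> 0 < s < 1 ->
  whp (fun n => [set w | y <= X 0%N w -> (m n w)%:R <= n%:R * s]).
Proof.
move=> yx s01; apply: whp_LSU_le => // u _.
exact: (dfun_gt_lt0 _ _ alpha01 rho01 _ tangent).
Qed.

Lemma whp_LSU_above y (s : R) : a < s < 1 -> y < x0t alpha rho (alpha * s) ->
  whp (fun n => [set w | X 0%N w <= y -> n%:R * s < (m n w)%:R]).
Proof.
move=> /andP[a_s s1] yx; have /andP[a_0 _] := crit_level01.
have [ds _ _] : [/\ d (Phiinv (1 - alpha * s)) (x0t alpha rho (alpha * s)) = 0,
    Phiinv (1 - alpha * s) < uc & x0t alpha rho (alpha * s) < x0s].
  by apply: x0t_above; rewrite gtr_pMr// s1 andbT mulrC -ltr_pdivrMr.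
apply: whp_LSU_ge => //; first by rewrite (lt_trans a_0).
by rewrite -ds; exact: dfun_decr.
Qed.

(** At X_0 = [x0t] (alpha s) the curve is below the line at all levels beyond alpha s; the larger
    value y makes the inequality strict at alpha s as well. *)
Lemma whp_LSU_below y (s : R) : a < s < 1 -> x0t alpha rho (alpha * s) < y ->
  whp (fun n => [set w | y <= X 0%N w -> (m n w)%:R <= n%:R * s]).
Proof.
move=> /andP[a_s s1] yx; have /andP[a_0 _] := crit_level01.
have [ds us _] : [/\ d (Phiinv (1 - alpha * s)) (x0t alpha rho (alpha * s)) = 0,
    Phiinv (1 - alpha * s) < uc & x0t alpha rho (alpha * s) < x0s].
  by apply: x0t_above; rewrite gtr_pMr// s1 andbT mulrC -ltr_pdivrMr.
have [hneg _] := dfun_zero_cross _ _ alpha01 rho01 _ tangent _ _ us ds.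
apply: whp_LSU_le => //; first by rewrite (lt_trans a_0).
move=> u; rewrite le_eqVlt => /orP[/eqP ->|/hneg h].
  by rewrite -ds; exact: dfun_decr.
by apply: lt_trans h; exact: dfun_decr.
Qed.

(** Below the tangent value there are more than a n rejections but only o(n) false hypotheses, so
    the ratio tends to 1; above it, [whp_Vn_le] sends the ratio to 0. *)
Lemma FDR_limit :
  (\int[P]_w ((V n w)%:R / (maxn (Rn alpha rho Xf tr n w) 1)%:R)%R%:E)%E
    @[n --> \oo] --> (Phi (x0t alpha rho t2))%:E.
Proof.
rewrite (x0t_t2 _ _ alpha01 rho01 _ tangent).
apply: (cvg_integral_threshold P (X 0%N) (normalX 0%N)).
- move=> n; rewrite (_ : (fun w => _) = (fun w =>
    (fun k => (k%:R - (F n)%:R) / (maxn k 1)%:R) (m n w))).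
    exact: (measurable_LSU_m alpha rho Xf tr alpha01 mX n
      (fun k => (k%:R - (F n)%:R) / (maxn k 1)%:R)).
  by apply/funext => w; rewrite VnB Rn_LSU_m.
- move=> n w; rewrite divr_ge0//= ler_pdivrMr ?ltr0n ?leq_max ?orbT// mul1r.
  rewrite ler_nat Rn_LSU_m //; apply: leq_trans (leq_maxl _ _).
  by rewrite -(VnE alpha rho Xf tr alpha01 n w) leq_addr.
- move=> y e yx e0; apply: (whp_near _ _ _ (whp_LSU_crit _ yx)).
  have /andP[a_0 _] := crit_level01.
  near=> n => w /= h xy; have {h} mw := h xy.
  have hF : (F n)%:R < e * a * n%:R.
    by near: n; apply: near_false_hyps => //; rewrite mulr_gt0.
  have n0 : 0 < n%:R :> R.
    by rewrite (lt_le_trans ltr01)//; near: n; exact: near_natr_ge.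
  have m0 : 0 < (m n w)%:R :> R by rewrite (lt_trans _ mw)// mulr_gt0.
  rewrite Rn_LSU_m // VnB (maxn_idPl _) -?(ltr0n R)// mulrBl divff ?gt_eqF//.
  rewrite lerD2l lerN2 ler_pdivrMr// (le_trans (ltW hF))// -mulrA.
  by rewrite ler_pM2l// mulrC ltW.
- move=> y e yx e0.
  have hV : whp (fun n => [set w | y <= X 0%N w -> (V n w)%:R <= e * (m n w)%:R]).
    by apply: whp_Vn_le => // u; exact: (dfun_gt_lt0 _ _ alpha01 rho01 _ tangent).
  apply: (whp_near _ _ _ hV); near=> n => w /= h xy.
  rewrite ler_pdivrMr ?ltr0n ?leq_max ?orbT// (le_trans (h xy))// ler_pM2l//.
  by rewrite ler_nat Rn_LSU_m // leq_maxl.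
Unshelve. all: by end_near. Qed.

(** The limit, for almost every s > 0, of the probability that the rejected fraction exceeds s. It
    is constant up to a because the limiting fraction jumps from a to 0 at the tangent value. *)
Definition asymptotic_ccdf (s : R) : R :=
  if s <= a then Phi x0s else if s < 1 then Phi (x0t alpha rho (alpha * s)) else 0.

Let Y n w : R := (m n w)%:R / n%:R.

Lemma measurable_rejected_fraction n : measurable_fun setT (Y n).
Proof. exact: (measurable_LSU_m alpha rho Xf tr alpha01 mX n (fun k => k%:R / n%:R)). Qed.

Lemma cvg_prob_level (s xi : R) : 0 <= s ->
  (forall y, y < xi -> whp (fun n => [set w | X 0%N w <= y -> n%:R * s < (m n w)%:R])) ->
  (forall y, xi < y -> whp (fun n => [set w | y <= X 0%N w -> (m n w)%:R <= n%:R * s])) ->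
  P [set w | s < Y n w] @[n --> \oo] --> (Phi xi)%:E.
Proof.
move=> s0 lower upper.
have mYs n : measurable [set w | s < Y n w].
  rewrite (_ : [set _ | _] = setT `&` Y n @^-1` `]s, +oo[).
    by apply: measurable_rejected_fraction => //; exact: measurable_itv.
  by rewrite setTI; apply/seteqP; split => w /=; rewrite in_itv/= andbT.
have -> : (fun n => P [set w | s < Y n w]) =
    (fun n => (\int[P]_w (\1_[set w | s < Y n w] w)%:E)%E).
  by apply/funext => n; rewrite integral_indic// setIT.
apply: (cvg_integral_threshold P (X 0%N) (normalX 0%N)).
- by move=> n; exact: measurable_indic.
- by move=> n w; rewrite indicE; case: (_ \in _); rewrite ?lexx ?ler01.
- move=> y e yx e0; apply: (whp_near _ _ _ (lower _ yx)); near=> n => w /= h xy.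
  have n0 : 0 < n%:R :> R.
    by rewrite (lt_le_trans ltr01)//; near: n; exact: near_natr_ge.
  rewrite indicE mem_set/= ?gerBl ?ltW//.
  by rewrite /Y ltr_pdivlMr// mulrC h.
- move=> y e yx e0; apply: (whp_near _ _ _ (upper _ yx)); near=> n => w /= h xy.
  have n0 : 0 < n%:R :> R.
    by rewrite (lt_le_trans ltr01)//; near: n; exact: near_natr_ge.
  rewrite indicE memNset/= ?ltW//.
  by apply/negP; rewrite -leNgt /Y ler_pdivrMr// mulrC h.
Unshelve. all: by end_near. Qed.

(** Serves the measurability of [asymptotic_ccdf]; between a and 1 it comes from [x0t_decr]. *)
Lemma asymptotic_ccdf_noninc : nonincreasing_fun asymptotic_ccdf.
Proof.
have above s : a < s -> s < 1 -> x0t alpha rho (alpha * s) < x0s.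
  move=> a_s s1.
  have [] : [/\ d (Phiinv (1 - alpha * s)) (x0t alpha rho (alpha * s)) = 0,
    Phiinv (1 - alpha * s) < uc & x0t alpha rho (alpha * s) < x0s] => //.
  by apply: x0t_above; rewrite gtr_pMr// s1 andbT mulrC -ltr_pdivrMr.
move=> s t st; rewrite /asymptotic_ccdf.
have [sa|a_s] := leP s a; have [ta|a_t] := leP t a => //.
- case: ifPn => [t1|_]; last exact/ltW/Phi_gt0.
  by rewrite ler_Phi ltW// above.
- by move: (lt_le_trans a_s st); rewrite ltNge ta.
have [s1|s1] := ltP s 1; have [t1|t1] := ltP t 1 => //.
- rewrite ler_Phi; move: st; rewrite le_eqVlt => /orP[/eqP ->//|st].
  apply/ltW/x0t_decr; last by rewrite gtr_pMr.
    by rewrite mulrC -ltr_pdivrMr.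
  by rewrite ltr_pM2l.
- exact/ltW/Phi_gt0.
- by move: (le_lt_trans s1 (le_lt_trans st t1)); rewrite ltxx.
Qed.

Lemma cvg_ccdf (s : R) : 0 < s -> s != a ->
  P [set w | s < Y n w] @[n --> \oo] --> (asymptotic_ccdf s)%:E.
Proof.
move=> s0 sa; rewrite /asymptotic_ccdf; have /andP[a_0 a_1] := crit_level01.
have [s_a|a_s] := leP s a.
  have s1 : s < 1 by exact: le_lt_trans s_a a_1.
  apply: cvg_prob_level => [|y yx|y yx]; first exact: ltW.
    apply: (whp_near _ _ _ (whp_LSU_crit _ yx)); near=> n => w /= h /h.
    by apply: le_lt_trans; rewrite ler_wpM2l.
  by apply: whp_LSU_small => //; rewrite s0.
have [s1|s1] := ltP s 1.
  apply: cvg_prob_level => [|y yx|y yx]; first exact: ltW.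
    by apply: whp_LSU_above => //; rewrite a_s.
  by apply: whp_LSU_below => //; rewrite a_s.
rewrite (_ : (fun n => _) = cst 0%E); first exact: cvg_cst.
apply/funext => n; rewrite (_ : [set _ | _] = set0) ?measure0//.
apply/seteqP; split => // w /=; apply/negP; rewrite -leNgt (le_trans _ s1)//.
rewrite /Y; have [->|n0] := posnP n; first by rewrite invr0 mulr0.
by rewrite ler_pdivrMr ?ltr0n// mul1r ler_nat LSU_m_le.
Unshelve. all: by end_near. Qed.

(** * The EER as an integral of tail probabilities *)

Local Notation h := asymptotic_ccdf.
Local Notation mu := (@lebesgue_measure R).

Let mY n : measurable_fun setT (Y n).
Proof. exact: measurable_rejected_fraction. Qed.

Lemma rejected_fraction_le1 n w : Y n w <= 1.
Proof.
rewrite /Y; have [->|n0] := posnP n; first by rewrite invr0 mulr0.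
by rewrite ler_pdivrMr ?ltr0n// mul1r ler_nat LSU_m_le.
Qed.

Lemma expectation_tail n :
  (\int[P]_w (Y n w)%:E = \int[mu]_(r in `[0%R, +oo[) P [set w | (r < Y n w)%R])%E.
Proof.
pose Z : {RV P >-> R} := HB.pack (Y n) (isMeasurableFun.Build _ _ _ _ _ (mY n)).
have Z0 w : 0 <= Z w by rewrite /Z/= divr_ge0.
have := ge0_expectation_ccdf Z0; rewrite unlock /Z/= => ->.
apply: eq_integral => r _; rewrite /ccdf /distribution/=; congr (P _).
by apply/seteqP; split => w /=; rewrite in_itv/= andbT.
Qed.

Lemma measurable_tail n : measurable_fun setT (fun r : R => P [set w | r < Y n w]).
Proof.
pose Z : {RV P >-> R} := HB.pack (Y n) (isMeasurableFun.Build _ _ _ _ _ (mY n)).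
have := ccdf_measurable Z; congr measurable_fun.
apply/funext => r; rewrite /ccdf /distribution/=; congr (P _).
by apply/seteqP; split => w /=; rewrite in_itv/= andbT.
Qed.

Lemma measurable_asymptotic_ccdf : measurable_fun setT (fun r => (h r)%:E).
Proof.
apply/measurable_EFinP; apply: nonincreasing_measurable => //.
exact: asymptotic_ccdf_noninc.
Qed.

(** Dominated convergence: the rejected fraction is at most 1, so the indicator of [0, 1] dominates,
    and the points 0 and a form a null set. *)
Lemma cvg_tail_integral :
  (\int[mu]_(r in `[0%R, +oo[) P [set w | (r < Y n w)%R])%E @[n --> \oo] -->
  (\int[mu]_(r in `[0%R, +oo[) (h r)%:E)%E.
Proof.
have mD : measurable (`[0, +oo[%classic : set R) by exact: measurable_itv.
have [|||||_ _] := @dominated_convergence _ _ _ mu _ mD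
  (fun n r => P [set w | (r < Y n w)%R]) (fun r => (h r)%:E)
  (fun r => (\1_(`[0, 1]%classic : set R) r)%:E).
- by move=> n; apply: measurable_funTS; exact: measurable_tail.
- by apply: measurable_funTS; exact: measurable_asymptotic_ccdf.
- exists [set 0; a]; split.
  + by apply: measurableU; exact: measurable_set1.
  + by apply: countable_lebesgue_measure0; exact/finite_set_countable/finite_set2.
  move=> r /= hr; apply: contrapT => hra; apply: hr; rewrite in_itv/= andbT => r_0.
  apply: cvg_ccdf => //.
    by rewrite lt_neqAle r_0 andbT; apply/eqP => e; apply: hra; left.
  by apply/eqP => e; apply: hra; right.
- by apply: (integrableS measurableT) => //; exact: integrable_indic_itv.
- apply: aeW => r n /=; rewrite in_itv/= andbT => r_0.
  rewrite gee0_abs// indicE; have [r1|r1] := leP r 1.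
    rewrite mem_set/=; last by rewrite in_itv/= r_0.
    apply: probability_le1.
    rewrite (_ : [set _ | _] = setT `&` Y n @^-1` `]r, +oo[).
      by apply: mY => //; exact: measurable_itv.
    by rewrite setTI; apply/seteqP; split => w /=; rewrite in_itv/= andbT.
  rewrite (_ : [set _ | _] = set0) ?measure0 ?lee_fin//.
  apply/seteqP; split => // w /=; apply/negP; rewrite -leNgt.
  by rewrite (le_trans (rejected_fraction_le1 _ _))// ltW.
by [].
Qed.

Lemma integral_asymptotic_ccdf : (\int[mu]_(r in `[0%R, +oo[) (h r)%:E =
  (t2 * Phi (x0t alpha rho t2) / alpha)%R%:E +
     \int[mu]_(t in `[a, 1%R]) (Phi (x0t alpha rho (alpha * t)))%:E)%E.
Proof.
have /andP[a_0 a_1] : 0 < a < 1 by exact: crit_level01.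
have h0 r : (0 <= (h r)%:E)%E.
  rewrite lee_fin /asymptotic_ccdf; case: ifP => _; first exact/ltW/Phi_gt0.
  by case: ifP => // _; exact/ltW/Phi_gt0.
have mh (D : set R) : measurable_fun D (fun r => (h r)%:E).
  by apply: measurable_funTS; exact: measurable_asymptotic_ccdf.
rewrite (@itv_bndbnd_setU _ _ _ (BLeft a)) ?bnd_simp ?ltW//.
rewrite (@ge0_integral_setU _ _ _ mu _ _ _ _ _ (mh _))//=; last first.
  apply/disj_setPS => r [] /=; rewrite !in_itv/= andbT => /andP[_ ra] ar.
  by move: (lt_le_trans ra ar); rewrite ltxx.
congr (_ + _)%E.
  rewrite (eq_integral (cst (Phi x0s)%:E)); last first.
    move=> r; rewrite inE/= in_itv/= => /andP[_ ra].
    by rewrite /asymptotic_ccdf ltW.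
  rewrite integral_cst//= lebesgue_measure_itv/= lte_fin a_0 oppr0 adde0.
  rewrite -EFinM (x0t_t2 _ _ alpha01 rho01 _ tangent); congr (_%:E).
  by rewrite mulrCA mulrA.
rewrite (@itv_bndbnd_setU _ _ _ (BLeft 1)) ?bnd_simp ?ltW//.
rewrite (@ge0_integral_setU _ _ _ mu _ _ _ _ _ (mh _))//=; last first.
  apply/disj_setPS => r [] /=; rewrite !in_itv/= andbT => /andP[_ ra] ar.
  by move: (lt_le_trans ra ar); rewrite ltxx.
rewrite [X in (_ + X)%E]integral0_eq ?adde0; last first.
  move=> r /=; rewrite in_itv/= andbT => r1; rewrite /asymptotic_ccdf.
  by rewrite leNgt (lt_le_trans a_1 r1)/= ltNge r1.
(* The formulas agree at a since [x0t] t2 is the tangent value, while at 1 [asymptotic_ccdf] is 0;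
   that endpoint is a null set. *)
have hE : {in `[a, 1[%classic, (fun r => (h r)%:E) =1
    (fun r => (Phi (x0t alpha rho (alpha * r)))%:E)}.
  move=> r; rewrite inE/= in_itv/= => /andP[ar r1].
  rewrite /asymptotic_ccdf r1; have [ra|//] := leP r a.
  have -> : r = a by apply/eqP; rewrite eq_le ra.
  by rewrite mulrC divfK ?gt_eqF// (x0t_t2 _ _ alpha01 rho01 _ tangent).
rewrite -integral_itv_bndo_bndc; first exact: eq_integral.
exact: (eq_measurable_fun _ hE).
Qed.

(** By [VnE], V/n is the rejected fraction minus the proportion of false hypotheses, and the latter
    tends to 0. *)
Lemma EER_limit :
  (\int[P]_w ((V n w)%:R / n%:R)%R%:E)%E @[n --> \oo] -->
    ((t2 * Phi (x0t alpha rho t2) / alpha)%R%:E +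
     \int[mu]_(t in `[a, 1%R]) (Phi (x0t alpha rho (alpha * t)))%:E)%E.
Proof.
rewrite -integral_asymptotic_ccdf.
have VY n : (\int[P]_w ((V n w)%:R / n%:R)%R%:E =
    \int[mu]_(r in `[0%R, +oo[) P [set w | (r < Y n w)%R] - ((F n)%:R / n%:R)%R%:E)%E.
  rewrite -expectation_tail.
  have -> : (fun w => (Y n w)%:E) =
      (fun w => (((V n w)%:R / n%:R)%:E + cst ((F n)%:R / n%:R)%:E w)%E).
    by apply/funext => w; rewrite -EFinD -mulrDl (VnB) subrK.
  rewrite ge0_integralD//=; last first.
    apply/measurable_EFinP.
    rewrite (_ : (fun w => _) = (fun w => (fun k => (k%:R - (F n)%:R) / n%:R) (m n w))).
      exact: (measurable_LSU_m alpha rho Xf tr alpha01 (fun i => measurable_funPT (X i)) n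
        (fun k => (k%:R - (F n)%:R) / n%:R)).
    by apply/funext => w; rewrite (VnB).
  by rewrite integral_cst//= probability_setT mule1 addeK.
rewrite (funext VY); set lim := (\int[mu]_(r in _) (h r)%:E)%E.
rewrite -(sube0 lim).
apply: cvgeB; [by rewrite fin_num_adde_defl// | exact: cvg_tail_integral|].
apply: cvg_EFin; first by near=> n.
apply/cvgrPdist_lt => e e0; near=> n => /=.
have n0 : 0 < n%:R :> R.
  by rewrite (lt_le_trans ltr01)//; near: n; exact: near_natr_ge.
rewrite sub0r normrN ger0_norm ?divr_ge0// ltr_pdivrMr//.
by near: n; exact: near_false_hyps.
Unshelve. all: by end_near. Qed.

End LSU_limits.

Theorem theorem3p2 (R : realType) (d : measure_display) (T : measurableType d)
  (P : probability T R) (alpha rho : R)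
  (X : nat -> {RV P >-> R}) (tr : nat -> nat -> bool) (x0s : R) :
  0 < alpha < 1 -> 0 < rho < 1 ->
  (forall i, distribution P (X i) = normal_prob 0 1 :> (set R -> \bar R)) ->
  mutually_independent P (fun i => (X i : T -> R)) ->
  zeta tr n @[n --> \oo] --> (1 : R) ->
  tangent_point alpha rho x0s ->
  let t2 := 1 - Phi (u2 alpha rho x0s) in
  C1 alpha rho = [set 0] `|` (`]t2, alpha[) /\
  (\int[P]_w ((Vn alpha rho (fun i => (X i : T -> R)) tr n w)%:R / n%:R)%R%:E)%E
    @[n --> \oo] -->
    ((t2 * Phi (x0t alpha rho t2) / alpha)%R%:E +
     \int[@lebesgue_measure R]_(t in `[(t2 / alpha)%R, 1%R]) (Phi (x0t alpha rho (alpha * t)))%:E)%E /\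
  (\int[P]_w ((Vn alpha rho (fun i => (X i : T -> R)) tr n w)%:R /
              (maxn (Rn alpha rho (fun i => (X i : T -> R)) tr n w) 1)%:R)%R%:E)%E
    @[n --> \oo] --> (Phi (x0t alpha rho t2))%:E.
Proof.
move=> alpha01 rho01 normalX indepX zeta1 tangent t2; split.
  exact: C1E.
split; first exact: EER_limit.
exact: FDR_limit.
Qed.
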